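(* Consider the aggregative game described in the context and suppose Assumptions 1, 2 and 3 listed in the context hold. If there exists some $T\ge 0$ such that the decaying factors $\gamma^k$ and the stepsizes $\lambda^k$ satisfy $$\sum_{k=T}^{\infty}\gamma^k=\infty,\qquad \sum_{k=T}^{\infty}\lambda^k=\infty,\qquad \sum_{k=T}^{\infty}(\gamma^k)^2<\infty,\qquad \sum_{k=T}^{\infty}\frac{(\lambda^k)^2}{\gamma^k}<\infty,$$ then Algorithm 1 (described in the context) converges to the Nash equilibrium $\mathbf x^*=[x_1^*,\dots,x_N^*]^T$ of the game almost surely, i.e. $\lim_{k\to\infty}|x_i^k-x_i^*|=0$ almost surely for all $i\in\mathcal N$.
   Context: **Game.** There are $N$ players $\mathcal N=\{1,\dots,N\}$. Player $i$ has a decision set $\Omega_i\subset\mathbb R$ and decision $x_i\in\Omega_i$. Write $\mathbf x=[x_1,\dots,x_N]^T\in\Omega=\Omega_1\times\cdots\times\Omega_N$, $\bar x=\frac1N\sum_{i=1}^N x_i$, and $\bar\Omega=\frac1N(\Omega_1+\cdots+\Omega_N)$ (Minkowski sum). Player $i$ has cost $\tilde f_i(x_i,\mathbf x_{-i})=f_i(x_i,\bar x)$, where $\mathbf x_{-i}$ collects the decisions of the other players, and the game is: $\min f_i(x_i,\bar x)$ subject to $x_i\in\Omega_i$ and $\bar x\in\bar\Omega$. A Nash equilibrium (NE) is $\mathbf x^*\in\Omega$ with $\tilde f_i(x_i^*,\mathbf x_{-i}^* )\le\tilde f_i(x_i,\mathbf x_{-i}^* )$ for all $x_i\in\Omega_i$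 and all $i\in\mathcal N$. **Gradient maps.** $F_i(x_i,u)=\nabla_{x_i}f_i(x_i,u)$, $F(\mathbf x,u)=[F_1(x_1,u),\dots,F_N(x_N,u)]^T$, and $\phi(\mathbf x)=F(\mathbf x,\bar x)$. **Assumption 1.** For each $i\in\mathcal N$, $\Omega_i$ is compact and convex, $f_i(x_i,u)$ is convex in $x_i$ over $\Omega_i$, and $f_i(x_i,u)$ is continuously differentiable in $(x_i,u)$ over some open set containing $\Omega_i\times\bar\Omega$. **Assumption 2.** $F_i(x_i,u)$ is Lipschitz continuous in $u$: there is $l>0$ such that $|F_i(x_i,u_1)-F_i(x_i,u_2)|\le l|u_1-u_2|$ for any fixed $x_i\in\Omega_i$ and all $u_1,u_2\in\bar\Omega$. **Assumption 3.** $\phi$ is strictly monotone over $\Omega$: $(\phi(\mathbf x)-\phi(\mathbf x'))^T(\mathbf x-\mathbf x')>0$ for all $\mathbf x\ne\mathbf x'$. Under Assumptions 1 and 3 the NE is unique. **Communication graph.** $\mathcal G=(\mathcal N,\mathcal E)$ is an undirected connected graph; $(j,i)\in\mathcal E$ means that player $i$ can obtain information from player $j$. The weight matrix $L=\{L_{ij}\}$ is symmetric, with $L_{ij}>0$ if $(j,i)\in\mathcal E$ and $L_{ij}=0$ otherwise for $j\ne i$; $\mathbb N_i$ is the set of $j$ with $L_{ij}>0$, and $L_{ii}=-\sum_{j\in\mathbb N_i}L_{ij}$. Thus $\mathbf 1^TL=\mathbf 0^T$ and $L\mathbf 1=\mathbf 0$. **Stochastic quantizer.** For a quantization interval $d>0$,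 $n\in\mathbb Z$ and $z\in[0,d]$, $Q(z+nd)=nd$ with probability $1-\frac zd$ and $Q(z+nd)=(n+1)d$ with probability $\frac zd$. **Algorithm 1.** Parameters: $\sigma>1$, trigger threshold tuning coefficient $c>0$, $a>0$, $d>0$, stepsizes $\lambda^k$, decaying factors $\gamma^k>0$. For each $i$, $\xi_i^k$ is a stationary ergodic random process taking values in $(a,1)$, with $\xi_i^k\sim\mathrm{Uniform}(a,1)$. Initialization: $y_i^0=x_i^0$. At each iteration $k=0,1,2,\dots$, each player $i\in\mathcal N$ does the following. (a) Stochastic event-triggering: if $k=0$, set $\varsigma_i^0=1$ and $\tau_i(0)=0$. If $k\ge1$, compute $\rho_i^k=\tilde y_i^{\tau_i(k-1)}-y_i^k$, generate $\xi_i^k\sim\mathrm{Uniform}(a,1)$, and check whether $\xi_i^k>\sigma e^{-c(\rho_i^k)^2/\gamma^k}$; if so, set $\varsigma_i^k=1$ and $\tau_i(k)=k$; otherwise set $\varsigma_i^k=0$ and $\tau_i(k)=\tau_i(k-1)$. (b) Stochastic quantization and communication: if $\varsigma_i^k=1$, player $i$ computes $Q(y_i^k)$, broadcasts it to all its neighbours and sets $\tilde y_i^k=Q(y_i^k)$; otherwise it sends nothing and $\tilde y_i^k=\tilde y_i^{k-1}$. On receiving a new message $Q(y_j^k)$ from $j\in\mathbb N_i$ it sets $\tilde y_j^k=Q(y_j^k)$; if none is received, $\tilde y_j^k=\tilde y_j^{k-1}$. (c) Decision update: $$x_i^{k+1}=\Pi_{\Omega_i}\bigl[x_i^k-\lambda^kF_i(x_i^k,y_i^k)\bigr],$$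 $$y_i^{k+1}=y_i^k+\gamma^k\sum_{j\in\mathbb N_i}L_{ij}(\tilde y_j^k-\tilde y_i^k)+x_i^{k+1}-x_i^k,$$ where $\Pi_{\Omega_i}$ is Euclidean projection onto $\Omega_i$.
   Formalization: F_i is the total derivative of f_i(x_i, x̄) in x_i (∂₁f_i + (1/N)∂₂f_i), since with ∂₁f_i alone the limit need not be the NE; as y_i^k may leave Ω̄, where F_i is not prescribed, the algorithm uses any continuous extension of F_i from Ω_i×Ω̄ to Ω_i×ℝ. *)

(* Defs.v *)
From HB Require Import structures.
From mathcomp Require Import all_boot all_order all_algebra.
From mathcomp Require Import all_classical all_reals all_analysis.

Set Implicit Arguments.
Unset Strict Implicit.
Unset Printing Implicit Defensive.

Import Order.TTheory GRing.Theory Num.Theory.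
Import numFieldNormedType.Exports.

Local Open Scope classical_set_scope.
Local Open Scope ring_scope.

Section Game.
Context {R : realType} {N : nat}.
Implicit Types (Om : 'I_N -> set R) (f : 'I_N -> R * R -> R).

Definition profiles Om : set ('I_N -> R) := [set x | forall i, Om i (x i)].

Definition avg (x : 'I_N -> R) : R := N%:R^-1 * \sum_i x i.

Definition avg_set Om : set R := avg @` profiles Om.

Definition cost f i (x : 'I_N -> R) : R := f i (x i, avg x).

(* The coupling constraint on the average holds for every profile in the
   product of the decision sets. *)
Definition nash_equilibrium Om f (x : 'I_N -> R) : Prop :=
  profiles Om x /\
  forall i z, Om i z -> cost f i x <= cost f i [eta x with i |-> z].

(* F_i(x_i, u): gradient of f_i in x_i when u stands for the average of the
   decisions. The average moves by 1/N when x_i moves by 1, hence the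
   direction (1, 1/N); by the chain rule this is
   d_1 f_i (x_i, u) + (1/N) d_2 f_i (x_i, u), and at u = avg x it is the
   partial derivative in x_i of cost f i. (With d_1 f_i alone the zeros of
   the game map would not be Nash equilibria.) *)
Definition grad f i (x u : R) : R :=
  'D_((1 : R^o, N%:R^-1 : R^o)) (f i : R^o * R^o -> R^o) (x, u).

Definition game_map f (x : 'I_N -> R) : 'I_N -> R := fun i => grad f i (x i) (avg x).

Definition continuously_differentiable_on
    (U : set (R^o * R^o)) (g : R^o * R^o -> R^o) : Prop :=
  forall p, U p ->
    differentiable g p /\ forall v, {for p, continuous (fun q => 'D_v g q)}.

Definition regular_game Om f : Prop := forall i,
  [/\ compact (Om i),
      convex_set (Om i : set R^o),
      forall u, avg_set Om u ->
        convex_function (Om i : set R^o) (fun x : R^o => f i (x, u)) &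
      exists U : set (R^o * R^o), [/\ open U,
        Om i `*` avg_set Om `<=` U &
        continuously_differentiable_on U (f i)]].

Definition lipschitz_gradients Om f : Prop :=
  exists2 l : R, 0 < l & forall i x u1 u2,
    Om i x -> avg_set Om u1 -> avg_set Om u2 ->
    `|grad f i x u1 - grad f i x u2| <= l * `|u1 - u2|.

Definition strictly_monotone_game Om f : Prop := forall x x',
  profiles Om x -> profiles Om x' -> x <> x' ->
  0 < \sum_i (game_map f x i - game_map f x' i) * (x i - x' i).

(* The algorithm evaluates F_i at (x_i, y_i) where the estimate y_i of the
   average may leave avg_set Om, outside of which F_i is not prescribed by
   the assumptions on the game (already at the initial time, where y_i = x_i).
   G is the map it evaluates: any continuous map on Om i x R that coincides
   with F_i on Om i x avg_set Om. *)
Definition extends_gradient Om f (G : 'I_N -> R * R -> R) : Prop := forall i,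
  (forall x u, Om i x -> avg_set Om u -> G i (x, u) = grad f i x u) /\
  {within Om i `*` [set: R], continuous (G i)}.

Definition is_proj (A : set R) (v p : R) : Prop :=
  A p /\ forall z, A z -> `|v - p| <= `|v - z|.

End Game.

(* e j i: player i can obtain information from player j. *)
Definition connected_graph (N : nat) (e : rel 'I_N) : Prop :=
  symmetric e /\ forall i j, connect e i j.

Definition weight_matrix (R : realType) (N : nat) (e : rel 'I_N)
    (L : 'M[R]_N) : Prop :=
  [/\ L^T = L,
      forall i j, j != i -> e j i -> 0 < L i j,
      forall i j, j != i -> ~~ e j i -> L i j = 0 &
      forall i, L i i = - \sum_(j | 0 < L i j) L i j].

Section Processes.
Context {disp : measure_display} {S : measurableType disp} {R : realType}.
Variable P : probability S R.

Definition sequence_events : set (set (nat -> R)) :=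
  <<s [set B | exists k (A : set R),
                 measurable A /\ B = [set s | A (s k)]] >>.

Definition shift (s : nat -> R) : nat -> R := fun k => s k.+1.

Definition path_of (X : nat -> S -> R) (w : S) : nat -> R := fun k => X k w.

Definition stationary (X : nat -> S -> R) : Prop :=
  forall B, sequence_events B ->
    P (path_of X @^-1` (shift @^-1` B)) = P (path_of X @^-1` B).

Definition ergodic (X : nat -> S -> R) : Prop :=
  forall B, sequence_events B -> shift @^-1` B = B ->
    P (path_of X @^-1` B) = 0%E \/ P (path_of X @^-1` B) = 1%E.

Definition trigger_process (a : R) (a1 : a < 1)
    (xi : nat -> {RV P >-> R}) : Prop :=
  [/\ forall k w, a < xi k w < 1,
      forall k (A : set R), measurable A ->
        distribution P (xi k) A = uniform_prob a1 A,
      stationary xi & ergodic xi].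

(* On the event D, w is drawn as Q(v), conditionally on the sigma-algebra H:
   on {v = z + n d, 0 <= z <= d}, w = n d with conditional probability
   1 - z / d and w = (n + 1) d with conditional probability z / d. *)
Definition stochastic_quantization (d : R) (H : set (set S)) (D : set S)
    (v w : S -> R) : Prop :=
  forall (n : int) (A : set S), H A -> A `<=` D ->
    (forall s, A s -> n%:~R * d <= v s <= (n + 1)%:~R * d) ->
    P (A `&` [set s | w s = n%:~R * d]) =
      (\int[P]_(s in A) (1 - (v s - n%:~R * d) / d)%:E)%E /\
    P (A `&` [set s | w s = (n + 1)%:~R * d]) =
      (\int[P]_(s in A) ((v s - n%:~R * d) / d)%:E)%E.

Context {N : nat}.

(* Information available when the quantizer is called at iteration k: the
   trigger variables up to k and the broadcast values before k. *)
Definition history (xi yt : 'I_N -> nat -> {RV P >-> R}) (k : nat) :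
    set (set S) :=
  <<s [set A | exists i j (B : set R), measurable B /\
         ((j <= k)%N /\ A = xi i j @^-1` B \/
          (j < k)%N /\ A = yt i j @^-1` B)] >>.

(* x, y : decisions and estimates of the average; yt : last broadcast
   (quantized) values; trig, tau : triggering decision and last triggering
   time; xi : trigger variables; G : see extends_gradient. *)
Record algorithm_run (Om : 'I_N -> set R) (G : 'I_N -> R * R -> R)
    (L : 'M[R]_N) (sigma c a d : R) (a1 : a < 1) (lambda gamma : nat -> R)
    (x0 : 'I_N -> R) (xi : 'I_N -> nat -> {RV P >-> R})
    (x y : 'I_N -> nat -> S -> R) (yt : 'I_N -> nat -> {RV P >-> R})
    (trig : 'I_N -> nat -> S -> bool) (tau : 'I_N -> nat -> S -> nat) : Prop
:= AlgorithmRun {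
  run_xi : forall i, trigger_process a1 (xi i);
  run_x0 : forall i w, x i 0%N w = x0 i;
  run_y0 : forall i w, y i 0%N w = x i 0%N w;
  run_trig0 : forall i w, trig i 0%N w = true;
  run_tau0 : forall i w, tau i 0%N w = 0%N;
  run_trigS : forall i k w, trig i k.+1 w =
    (sigma * expR (- c * (yt i (tau i k w) w - y i k.+1 w) ^+ 2 / gamma k.+1)
      < xi i k.+1 w);
  run_tauS : forall i k w,
    tau i k.+1 w = if trig i k.+1 w then k.+1 else tau i k w;
  run_quantize : forall i k,
    stochastic_quantization d (history xi yt k) [set w | trig i k w]
      (y i k) (yt i k);
  run_hold : forall i k w, ~~ trig i k.+1 w -> yt i k.+1 w = yt i k w;
  run_x : forall i k w,
    is_proj (Om i) (x i k w - lambda k * G i (x i k w, y i k w)) (x i k.+1 w);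
  run_y : forall i k w, y i k.+1 w =
    y i k w + gamma k * (\sum_(j | 0 < L i j) L i j * (yt j k w - yt i k w))
    + x i k.+1 w - x i k w
}.

End Processes.

(* Main.v *)
Require Import Defs.
From HB Require Import structures.
From mathcomp Require Import all_boot all_order all_algebra.
From mathcomp Require Import all_classical all_reals all_analysis.
From mathcomp Require Import measurable_realfun ring lra.
Import Order.TTheory GRing.Theory Num.Theory.
Import numFieldNormedType.Exports.
Local Open Scope classical_set_scope.
Local Open Scope ring_scope.

(** Why the algorithm converges.

    Equilibria. With the gradient taken along (1, 1/N), the map F(x, avg x) is
    the vector of partial derivatives of the costs. Strict monotonicity along one
    coordinate makes every cost convex in the own decision, so that Nash
    equilibria are the solutions of the variational inequality of this map
    ([variational_nash], [nash_variational]). Uniqueness is strict monotonicity;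
    existence follows from averaging projected gradient steps and from Minty's
    lemma ([variational_solution]).

    Noise. The value that a player broadcasts is its estimate plus an error,
    which splits into two parts. At triggering times it is the quantization
    error, which has mean zero given the past and is almost surely at most d;
    since the squares of gamma are summable, the series of gamma times this noise
    is an L2 bounded martingale and converges almost surely
    ([noise_series_cvg], by way of Kolmogorov's maximal inequality). At other
    times the trigger bounds the error by a multiple of the square root of gamma
    ([bias_le]), which tends to 0. The rest of the proof is deterministic, on one
    trajectory.

    Consensus. The graph is connected and L is symmetric, so that one exchange
    contracts the disagreement by a factor 1 - c gamma and preserves the sum of
    the estimates, which therefore equals the sum of the decisions forever. The
    convergent noise series is absorbed in a change of variables
    ([noise_removal]). As the decisions live in compact sets, y - x stays
    bounded, hence so do the gradients; then decisions move by O(lambda), and the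
    summability of lambda^2 / gamma forces y - avg x to 0
    ([estimates_consensus]).

    Descent. The gradients are therefore evaluated at asymptotically exact
    averages. Outside any ball around the equilibrium xs the product of the
    gradients with x - xs is bounded below by a positive constant, by strict
    monotonicity and compactness ([uniform_separation]), so that each step
    decreases the squared distance to xs by a multiple of lambda; as lambda tends
    to 0 and has a divergent sum, x enters every ball and stays there
    ([gradient_play_cvg]). *)

(** * Real sequences *)

Section ScalarSequences.
Context {R : realType}.
Implicit Types (u v lam al rho bet : nat -> R).

Lemma cvg_sumr {T I : Type} (F : set_system T) {FF : Filter F} (r : seq I)
    (f : I -> T -> R) (l : I -> R) :
  (forall i, f i x @[x --> F] --> l i) ->
  \sum_(i <- r) f i x @[x --> F] --> \sum_(i <- r) l i.
Proof. by move=> fl; apply: cvg_big => //; exact: add_continuous. Qed.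

(** Divergence and summability are used through finite sums only; for a
    nonnegative u the second one is the Cauchy criterion. *)
Definition divergent_sums u : Prop :=
  forall (K : nat) (A : R), exists n, A <= \sum_(K <= j < n) u j.

Definition vanishing_tails u : Prop := forall eps : R, 0 < eps ->
  exists K, forall m n, (K <= m)%N -> \sum_(m <= j < n) u j <= eps.

(** Above del the sequence loses at least lam k * eta at each step, which cannot
    go on forever since the sums of lam diverge; once below del, it never climbs
    above del' again. *)
Lemma eventually_le {v lam} {del del' eta : R} {K : nat} :
  divergent_sums lam -> (forall k, 0 <= lam k) -> 0 < eta -> del <= del' ->
  (forall k, (K <= k)%N -> del <= v k -> v k.+1 <= v k - lam k * eta) ->
  (forall k, (K <= k)%N -> v k < del -> v k.+1 <= del') ->
  exists K', forall k, (K' <= k)%N -> v k <= del'.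
Proof.
move=> dlam lam0 eta0 dd' hi lo.
have [k0 [Kk0 vk0]] : exists k0, (K <= k0)%N /\ v k0 < del.
  apply: contrapT => no.
  have big k : (K <= k)%N -> del <= v k.
    by move=> Kk; rewrite leNgt; apply/negP => ?; apply: no; exists k.
  have desc n : (K <= n)%N -> v n <= v K - eta * \sum_(K <= j < n) lam j.
    elim: n => [|n IH].
      by rewrite leqn0 => /eqP ->; rewrite big_geq// mulr0 subr0.
    rewrite leq_eqVlt => /orP[/eqP <-|]; first by rewrite big_geq// mulr0 subr0.
    rewrite ltnS => Kn; rewrite big_nat_recr//=.
    have := hi n Kn (big n Kn); have := IH Kn; lra.
  have vK := big K (leqnn K).
  have [n An] := dlam K ((v K - del) / eta + 1).
  have An' : v K - del + eta <= eta * \sum_(K <= j < n) lam j.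
    apply: le_trans (ler_wpM2l (ltW eta0) An).
    by rewrite mulrDr mulr1 mulrCA divff ?gt_eqF// mulr1.
  have [nK|Kn] := leqP n K.
    by move: An'; rewrite big_geq// mulr0; lra.
  have := desc n (ltnW Kn); have := big n (ltnW Kn); lra.
exists k0 => k; elim: k => [|k IH].
  by rewrite leqn0 => /eqP k00; move: vk0; rewrite k00; lra.
rewrite leq_eqVlt => /orP[/eqP <-|]; first lra.
rewrite ltnS => k0k; have Kk := leq_trans Kk0 k0k.
have [dv|] := leP del (v k); last exact: lo.
have := hi k Kk dv; have := IH k0k.
have : 0 <= lam k * eta by rewrite mulr_ge0// ltW.
lra.
Qed.

Lemma sum_nat_ge0 u (m n : nat) : (forall k, 0 <= u k) ->
  0 <= \sum_(m <= j < n) u j.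
Proof. by move=> u0; apply: sumr_ge0. Qed.

(** The relative perturbation rho is beaten by the contraction because it
    vanishes, the absolute perturbation bet because its tails are small. *)
Lemma perturbed_contraction_cvg0 v al rho bet :
  (forall k, 0 <= v k) -> (forall k, 0 <= al k) -> (forall k, 0 <= bet k) ->
  (\forall k \near \oo, al k <= 1 /\
     v k.+1 <= (1 - al k) * v k + al k * rho k + bet k) ->
  divergent_sums al -> rho @ \oo --> (0 : R) -> vanishing_tails bet ->
  v @ \oo --> (0 : R).
Proof.
move=> v0 al0 bet0 [K0 _ rec] dal rho0 vbet.
apply/cvgrPdist_le => eps eps0; set e := eps / 4.
have e0 : 0 < e by rewrite divr_gt0.
have /cvgrPdist_le/(_ _ e0)[K1 _ rhoe] := rho0.
have [K2 bete] := vbet _ e0.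
pose K := maxn K0 (maxn K1 K2).
(* subtracting the perturbations met so far leaves a pure contraction *)
pose z k := v k - \sum_(K <= j < k) bet j - e.
have zS k : (K <= k)%N -> z k.+1 <= (1 - al k) * z k.
  move=> Kk; have [a1 vS] : al k <= 1 /\
     v k.+1 <= (1 - al k) * v k + al k * rho k + bet k.
    by apply: rec => /=; apply: leq_trans Kk; rewrite leq_maxl.
  have : `|0 - rho k| <= e.
    by apply: rhoe => /=; apply: leq_trans Kk; rewrite /K maxnCA leq_maxl.
  rewrite sub0r normrN => /(le_trans (ler_norm _)) rk.
  have ar : al k * rho k <= al k * e by rewrite ler_wpM2l.
  have := @sum_nat_ge0 bet K k bet0 => B0.
  have aB : 0 <= al k * \sum_(K <= j < k) bet j by rewrite mulr_ge0.
  rewrite /z big_nat_recr//=; nra.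
have [K' zK'] : exists K', forall k, (K' <= k)%N -> z k <= e.
  apply: (eventually_le (K := K) dal al0 e0 (lexx e)) => k Kk zk; have := zS k Kk.
    have := ler_wpM2l (al0 k) zk; lra.
  have [a1 _] : al k <= 1 /\
     v k.+1 <= (1 - al k) * v k + al k * rho k + bet k.
    by apply: rec => /=; apply: leq_trans Kk; rewrite leq_maxl.
  have := al0 k; nra.
near=> k; rewrite sub0r normrN ger0_norm//.
have K'k : (K' <= k)%N by near: k; exists K'.
have := zK' _ K'k; rewrite /z.
have : \sum_(K <= j < k) bet j <= e.
  by apply: bete; rewrite /K maxnA leq_maxr.
rewrite /e; lra.
Unshelve. all: by end_near. Qed.

Lemma perturbed_contraction_bounded v al (B : R) :
  (forall k, 0 <= al k) ->
  (\forall k \near \oo, al k <= 1 /\ v k.+1 <= (1 - al k) * v k + al k * B) ->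
  exists M, forall k, v k <= M.
Proof.
move=> al0 [K _ rec].
pose M0 := \sum_(0 <= j < K.+1) `|v j|.
have M0P k : (k <= K)%N -> v k <= M0.
  move=> kK; apply: le_trans (ler_norm _) _.
  rewrite /M0 big_mkord (bigD1 (inord k))//= inordK// lerDl.
  exact: sumr_ge0.
exists (Num.max M0 B) => k; elim: k => [|k IH].
  by rewrite le_max M0P.
have [kK|Kk] := leqP k.+1 K; first by rewrite le_max M0P.
have [a1] : al k <= 1 /\ v k.+1 <= (1 - al k) * v k + al k * B by apply: rec.
move=> /le_trans; apply.
have := al0 k; have : B <= Num.max M0 B by rewrite le_max lexx orbT.
set M := Num.max _ _ in IH *; nra.
Qed.

Lemma divergent_sums_of_series {u} {T : nat} : (forall k, 0 <= u k) ->
  (\sum_(T <= k <oo) (u k)%:E = +oo)%E -> divergent_sums u.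
Proof.
move=> u0 uoo K A.
apply: contrapT => no.
have bnd n : \sum_(K <= j < n) u j <= A.
  by rewrite leNgt; apply/negP => An; apply: no; exists n; exact: ltW.
have : (\sum_(T <= k <oo) (u k)%:E <= (\sum_(0 <= j < K) u j + A)%:E)%E.
  apply: lime_le; first by apply: is_cvg_nneseries => n _ _; rewrite lee_fin.
  apply: nearW => n; rewrite sumEFin lee_fin.
  apply: (@le_trans _ _ (\sum_(0 <= j < K + n) u j)).
    have [nT|Tn] := leqP n T; first by rewrite big_geq// sum_nat_ge0.
    rewrite (@big_cat_nat _ _ _ n 0%N (K + n)%N)//= ?leq_addl//.
    rewrite (@big_cat_nat _ _ _ T 0%N n)//= ?(ltnW Tn)//.
    by rewrite addrAC lerDr addr_ge0// sum_nat_ge0.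
  rewrite (@big_cat_nat _ _ _ K 0%N (K + n)%N)//= ?leq_addr//.
  by rewrite lerD2l.
by rewrite uoo leye_eq.
Qed.

Lemma vanishing_tails_of_series {u} {T : nat} : (forall k, 0 <= u k) ->
  (\sum_(T <= k <oo) (u k)%:E < +oo)%E -> vanishing_tails u.
Proof.
move=> u0 uoo eps eps0.
have cu : cvgn (fun n => \sum_(T <= k < n) u k).
  apply: nondecreasing_is_cvgn.
    move=> m n mn; have [mT|Tm] := leqP m T.
      by rewrite big_geq// sum_nat_ge0.
    rewrite [leRHS](@big_cat_nat _ _ _ m)//= ?(ltnW Tm)//.
    by rewrite lerDl sum_nat_ge0.
  exists (fine (\sum_(T <= k <oo) (u k)%:E)%E) => _ [n _ <-].
  rewrite -lee_fin fineK; last first.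
    rewrite ge0_fin_numE//; apply: nneseries_ge0 => k _ _.
    by rewrite lee_fin.
  rewrite -sumEFin; apply: nneseries_lim_ge => k _ _.
  by rewrite lee_fin.
have eps20 : 0 < eps / 2 by rewrite divr_gt0.
have /cvgrPdist_le/(_ _ eps20)[K _ Kl] := cu.
exists (maxn K T) => m n; rewrite geq_max => /andP[Km Tm].
have [nm|mn] := leqP n m; first by rewrite big_geq// ltW.
have := Kl m Km; have := Kl n (leq_trans Km (ltnW mn)) => /=.
set l := lim _; rewrite (@big_cat_nat _ _ _ m T n)//= ?(ltnW mn)//.
rewrite !ler_norml => /andP[? ?] /andP[? ?]; lra.
Qed.

Lemma vanishing_tails_cvg0 u : (forall k, 0 <= u k) -> vanishing_tails u ->
  u @ \oo --> (0 : R).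
Proof.
move=> u0 vu; apply/cvgrPdist_le => eps /vu[K Ku].
exists K => // k /= Kk; rewrite sub0r normrN ger0_norm//.
by have := Ku k k.+1 Kk; rewrite big_nat1.
Qed.

Lemma vanishing_tailsZ u (c : R) : 0 <= c -> vanishing_tails u ->
  vanishing_tails (fun k => c * u k).
Proof.
move=> c0 vu eps eps0; have c1 : 0 < c + 1 by lra.
have [K Ku] := vu (eps / (c + 1)) (divr_gt0 eps0 c1).
exists K => m n Km; rewrite -mulr_sumr.
apply: le_trans (ler_wpM2l c0 (Ku m n Km)) _.
by rewrite mulrA ler_pdivrMr//; nra.
Qed.

Lemma divergent_sumsZ u (c : R) : 0 < c -> divergent_sums u ->
  divergent_sums (fun k => c * u k).
Proof.
move=> c0 du K A; have [n An] := du K (A / c).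
exists n; rewrite -mulr_sumr.
by rewrite -ler_pdivrMl// mulrC.
Qed.

End ScalarSequences.

(** * Consensus on a weighted graph *)

Section FiniteSums.
Context {R : realType} {N : nat}.
Implicit Types (u v r : 'I_N -> R).

Definition sqnorm v : R := \sum_i v i ^+ 2.

Lemma sqnorm_ge0 v : 0 <= sqnorm v.
Proof. by apply: sumr_ge0 => i _; rewrite sqr_ge0. Qed.

Lemma sqr_le_sqnorm v i : v i ^+ 2 <= sqnorm v.
Proof.
rewrite /sqnorm (bigD1 i)//= lerDl.
by apply: sumr_ge0 => j _; rewrite sqr_ge0.
Qed.

Lemma sum_sqr_diff v :
  \sum_i \sum_j (v j - v i) ^+ 2 = 2 * (N%:R * sqnorm v - (\sum_i v i) ^+ 2).
Proof.
have E i : \sum_j (v j - v i) ^+ 2 =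
    sqnorm v - 2 * v i * (\sum_j v j) + N%:R * v i ^+ 2.
  transitivity (\sum_j (v j ^+ 2 - 2 * v i * v j + v i ^+ 2)).
    by apply: eq_bigr => j _; ring.
  rewrite !big_split/= sumr_const card_ord -[_ *+ N]mulr_natl sumrN.
  by rewrite -mulr_sumr.
under eq_bigr do rewrite E.
rewrite !big_split/= sumr_const card_ord sumrN -mulr_suml -!mulr_sumr.
rewrite -/(sqnorm v) -[_ *+ N]mulr_natl; ring.
Qed.

Lemma sqr_sum_le v : (\sum_i v i) ^+ 2 <= N%:R * sqnorm v.
Proof.
have := sum_sqr_diff v.
have : 0 <= \sum_i \sum_j (v j - v i) ^+ 2.
  by apply: sumr_ge0 => i _; apply: sumr_ge0 => j _; rewrite sqr_ge0.
lra.
Qed.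

Lemma sqnormD_le {t : R} u v : 0 < t ->
  sqnorm (fun i => u i + v i) <= (1 + t) * sqnorm u + (1 + t^-1) * sqnorm v.
Proof.
move=> t0; rewrite /sqnorm !mulr_sumr -big_split/=; apply: ler_sum => i _.
have : 0 <= t^-1 * (t * u i - v i) ^+ 2 by rewrite mulr_ge0 ?sqr_ge0// invr_ge0 ltW.
suff -> : t^-1 * (t * u i - v i) ^+ 2 =
    t * u i ^+ 2 - 2 * u i * v i + t^-1 * v i ^+ 2 by lra.
by field; rewrite gt_eqF.
Qed.

Lemma sqnormZ (t : R) u : sqnorm (fun i => t * u i) = t ^+ 2 * sqnorm u.
Proof.
by rewrite /sqnorm mulr_sumr; apply: eq_bigr => i _; rewrite exprMn.
Qed.

End FiniteSums.

Section GraphLaplacian.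
Context {R : realType} {N : nat} {e : rel 'I_N} {L : 'M[R]_N}.
Hypothesis e_connected : connected_graph e.
Hypothesis L_weights : weight_matrix e L.
Implicit Types (u v r del : 'I_N -> R).

Definition laplacian v (i : 'I_N) : R := \sum_j L i j * (v j - v i).

Definition dirichlet v : R := \sum_i \sum_j L i j * (v j - v i) ^+ 2.

Lemma weight_sym i j : L i j = L j i.
Proof. by case: L_weights => LT _ _ _; rewrite -[in LHS]LT mxE. Qed.

Lemma weight_ge0 i j : j != i -> 0 <= L i j.
Proof.
case: L_weights => _ pos null _ ji.
by have [/(pos _ _ ji)/ltW//|/(null _ _ ji)->] := boolP (e j i).
Qed.

Lemma laplacianE v i :
  \sum_(j | 0 < L i j) L i j * (v j - v i) = laplacian v i.
Proof.
rewrite /laplacian big_mkcond/=; apply: eq_bigr => j _.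
case: ifPn => // L0; have [->|ji] := eqVneq j i; first by rewrite subrr mulr0.
have /eqP -> : L i j == 0; last by rewrite mul0r.
by rewrite eq_le weight_ge0// leNgt L0.
Qed.

Lemma laplacianD u v i :
  laplacian (fun j => u j + v j) i = laplacian u i + laplacian v i.
Proof. by rewrite -big_split; apply: eq_bigr => j _/=; ring. Qed.

Lemma laplacianZ (t : R) v i : laplacian (fun j => t * v j) i = t * laplacian v i.
Proof. by rewrite mulr_sumr; apply: eq_bigr => j _/=; ring. Qed.

Lemma laplacian_shift (t : R) v i :
  laplacian (fun j => v j + t) i = laplacian v i.
Proof. by apply: eq_bigr => j _/=; ring. Qed.

Lemma sum_laplacian v : \sum_i laplacian v i = 0.
Proof.
have E : \sum_i laplacian v i = - \sum_i laplacian v i.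
  rewrite [LHS]exchange_big/= -sumrN; apply: eq_bigr => i _.
  rewrite -sumrN; apply: eq_bigr => j _; rewrite weight_sym; ring.
lra.
Qed.

Lemma dot_laplacian v : 2 * (\sum_i v i * laplacian v i) = - dirichlet v.
Proof.
have E : \sum_i v i * laplacian v i = - \sum_i \sum_j v j * (L i j * (v j - v i)).
  rewrite exchange_big/= -sumrN; apply: eq_bigr => i _.
  rewrite mulr_sumr -sumrN; apply: eq_bigr => j _; rewrite weight_sym; ring.
rewrite mulr_natl mulr2n {2}E /dirichlet -sumrB -sumrN; apply: eq_bigr => i _.
rewrite mulr_sumr -sumrB -sumrN; apply: eq_bigr => j _; ring.
Qed.

Lemma sqnorm_laplacian_le : exists2 C : R, 0 < C &
  forall v, sqnorm (laplacian v) <= C * sqnorm v.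
Proof.
pose C := \sum_i N%:R * (\sum_j 4 * L i j ^+ 2).
have C0 : 0 <= C.
  apply: sumr_ge0 => i _; rewrite mulr_ge0//.
  by apply: sumr_ge0 => j _; rewrite mulr_ge0// sqr_ge0.
exists (C + 1); first lra.
move=> v; apply: (@le_trans _ _ (C * sqnorm v)); last first.
  by rewrite ler_wpM2r ?sqnorm_ge0// lerDl.
rewrite /C mulr_suml; apply: ler_sum => i _.
apply: le_trans (sqr_sum_le _) _; rewrite -mulrA ler_wpM2l//.
rewrite mulr_suml; apply: ler_sum => j _.
rewrite exprMn [4 * _]mulrC -[leRHS]mulrA ler_wpM2l ?sqr_ge0//.
have := sqr_le_sqnorm v i; have := sqr_le_sqnorm v j.
have := sqr_ge0 (v i + v j); nra.
Qed.

Lemma dirichlet_ge0 v : 0 <= dirichlet v.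
Proof.
apply: sumr_ge0 => i _; apply: sumr_ge0 => j _.
have [->|ji] := eqVneq j i; first by rewrite subrr expr0n mulr0.
by rewrite mulr_ge0 ?sqr_ge0// weight_ge0.
Qed.

Lemma edge_le_dirichlet v i j : L i j * (v j - v i) ^+ 2 <= dirichlet v.
Proof.
have F i' j' : 0 <= L i' j' * (v j' - v i') ^+ 2.
  have [->|ji] := eqVneq j' i'; first by rewrite subrr expr0n mulr0.
  by rewrite mulr_ge0 ?sqr_ge0// weight_ge0.
rewrite /dirichlet (bigD1 i)//= (bigD1 j)//= -addrA lerDl addr_ge0//.
  by apply: sumr_ge0.
by apply: sumr_ge0 => k _; apply: sumr_ge0.
Qed.

(** Induction along a path from i to j: an edge costs one term of the energy. *)
Lemma sqr_diff_le_dirichlet i j : exists2 C : R, 0 <= C &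
  forall v, (v j - v i) ^+ 2 <= C * dirichlet v.
Proof.
have /connectP[p] := e_connected.2 i j.
elim: p i => [|k p IH] i /=.
  by move=> _ ->; exists 0 => // v; rewrite subrr expr0n mul0r.
move=> /andP[eik ekp] jl; have [C C0 HC] := IH k ekp jl.
have [ki|ki] := eqVneq k i; first by exists C => // v; rewrite -ki.
have Lpos : 0 < L i k.
  by case: L_weights => _ pos _ _; apply: pos => //; rewrite e_connected.1.
exists (2 * C + 2 / L i k).
  by rewrite addr_ge0 ?mulr_ge0// invr_ge0 ltW.
move=> v; have h1 := HC v.
have h2 : (v k - v i) ^+ 2 <= dirichlet v / L i k.
  by rewrite ler_pdivlMr// mulrC edge_le_dirichlet.
have := sqr_ge0 ((v j - v k) - (v k - v i)).
rewrite mulrDl -!mulrA [_^-1 * _]mulrC; nra.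
Qed.

(** Poincare inequality: a path joins any two vertices, so that the energy
    controls every difference, and a mean-zero vector is controlled by its
    differences. *)
Lemma poincare : exists2 c : R, 0 < c &
  forall v, \sum_i v i = 0 -> c * sqnorm v <= dirichlet v.
Proof.
have /choice[C HC] : forall ij : 'I_N * 'I_N, exists C : R, 0 <= C /\
    forall v, (v ij.2 - v ij.1) ^+ 2 <= C * dirichlet v.
  by move=> [i j]; have [C C0 H] := sqr_diff_le_dirichlet i j; exists C.
pose B := \sum_i \sum_j C (i, j).
have B0 : 0 <= B.
  by apply: sumr_ge0 => i _; apply: sumr_ge0 => j _; case: (HC (i, j)).
have key v : \sum_i v i = 0 -> N%:R * sqnorm v <= B * dirichlet v.
  move=> v0; have := sum_sqr_diff v; rewrite v0 expr0n subr0.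
  have : \sum_i \sum_j (v j - v i) ^+ 2 <= B * dirichlet v.
    rewrite /B mulr_suml; apply: ler_sum => i _.
    rewrite mulr_suml; apply: ler_sum => j _.
    by case: (HC (i, j)).
  have : 0 <= N%:R * sqnorm v by rewrite mulr_ge0 ?sqnorm_ge0.
  lra.
have B1 : 0 < B + 1 by lra.
have [N0|N0] := posnP N.
  exists 1 => // v _; have -> : sqnorm v = 0.
    by apply: big1 => i _; have := ltn_ord i; rewrite [in X in (_ < X)%N]N0.
  by rewrite mulr0 dirichlet_ge0.
exists (N%:R / (B + 1)); first by rewrite divr_gt0// ltr0n.
move=> v /key; rewrite mulrAC ler_pdivrMr//.
have := dirichlet_ge0 v; nra.
Qed.

(** One step of consensus with small gain g contracts the disagreement, at the
    rate of the Poincare constant; Young's inequality with the weight c g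
    charges the perturbations r and del. *)
Lemma consensus_step : exists c g0 C : R,
  [/\ 0 < c, 0 < g0, 0 < C &
  forall (g : R) u r del, 0 < g -> g <= g0 -> \sum_i u i = 0 ->
    c * g <= 1 /\
    sqnorm (fun i => u i + g * (laplacian u i + r i) + del i) <=
    (1 - c * g) * sqnorm u + C * (g * sqnorm r) + C * (sqnorm del / g)].
Proof.
have [c c0 Pc] := poincare; have [B B0 PB] := sqnorm_laplacian_le.
(* gains below g0 make the quadratic term g^2 |lap u|^2 at most half of the
   dissipation, and keep the factor 1 - c g nonnegative *)
pose g0 := Num.min 1 (Num.min (c^-1) (c / (2 * B))).
have g00 : 0 < g0 by rewrite !lt_min ltr01 invr_gt0 c0 divr_gt0// mulr_gt0.
exists (c / 4), g0, (2 * (1 + 4 / c)).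
have C0 : 0 < 1 + 4 / c by rewrite addr_gt0// divr_gt0.
split; [exact: divr_gt0|exact: g00|exact: mulr_gt0|].
move=> g u r del gp; rewrite !le_min => /and3P[g1 gc gB] u0.
have gc' : c * g <= 1 by move: gc; rewrite -(ler_pM2l c0) divff// gt_eqF.
split; first lra.
have gB' : g * B <= c / 2.
  by move: gB; rewrite -(ler_pM2r B0) invfM mulrA divfK// gt_eqF.
pose p i := u i + g * laplacian u i.
pose q i := g * r i + del i.
have -> : (fun i => u i + g * (laplacian u i + r i) + del i) =
    (fun i => p i + q i).
  by apply/funext => i; rewrite /p /q; ring.
have V0 := sqnorm_ge0 u.
have pV : sqnorm p <= (1 - c / 2 * g) * sqnorm u.
  have -> : sqnorm p = sqnorm u + g * (2 * \sum_i u i * laplacian u i) +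
      g ^+ 2 * sqnorm (laplacian u).
    rewrite /sqnorm 3!mulr_sumr -!big_split/=; apply: eq_bigr => i _.
    by rewrite /p; ring.
  rewrite dot_laplacian.
  have h1 : g * (c * sqnorm u) <= g * dirichlet u.
    by rewrite ler_wpM2l ?Pc// ltW.
  have h2 : g ^+ 2 * sqnorm (laplacian u) <= g ^+ 2 * (B * sqnorm u).
    by rewrite ler_wpM2l ?PB// sqr_ge0.
  have h3 : g * (g * B) * sqnorm u <= g * (c / 2) * sqnorm u.
    by rewrite ler_wpM2r// ler_wpM2l// ltW.
  rewrite expr2 in h2 *; lra.
(* Young's inequality with weight c g / 4 gives back half of the remaining rate *)
have t0 : 0 < c / 4 * g by rewrite mulr_gt0// divr_gt0.
apply: le_trans (sqnormD_le p q t0) _.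
have qV : sqnorm q <= 2 * (g ^+ 2 * sqnorm r) + 2 * sqnorm del.
  have := sqnormD_le (fun i => g * r i) del ltr01.
  by rewrite invr1 sqnormZ.
have q0 := sqnorm_ge0 q.
have h1 : (1 + c / 4 * g) * sqnorm p <= (1 - c / 4 * g) * sqnorm u.
  apply: (@le_trans _ _ ((1 + c / 4 * g) * ((1 - c / 2 * g) * sqnorm u))).
    by rewrite ler_wpM2l//; lra.
  rewrite mulrA ler_wpM2r//; have : 0 <= (c * g) ^+ 2 by rewrite sqr_ge0.
  nra.
have h2 : (1 + (c / 4 * g)^-1) * sqnorm q <=
    2 * (1 + 4 / c) * (g * sqnorm r) + 2 * (1 + 4 / c) * (sqnorm del / g).
  have e1 : 1 + (c / 4 * g)^-1 <= (1 + 4 / c) / g.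
    have -> : (c / 4 * g)^-1 = 4 / c / g by field; rewrite !gt_eqF.
    by rewrite [leRHS]mulrDl lerD2r mul1r invf_ge1.
  apply: le_trans (ler_wpM2r q0 e1) _.
  have e2 : 0 <= (1 + 4 / c) / g by rewrite ltW// divr_gt0.
  apply: le_trans (ler_wpM2l e2 qV) _.
  rewrite le_eqVlt; apply/orP; left; apply/eqP; field.
  by rewrite !gt_eqF.
lra.
Qed.

End GraphLaplacian.

Arguments laplacian {R N} L v i.

(** * Noisy consensus iterations *)

Section VectorSequences.
Context {R : realType} {N : nat}.
Implicit Types (v : nat -> 'I_N -> R).

Definition vanishes v : Prop := forall i, v ^~ i @ \oo --> (0 : R).

Definition uniformly_bounded v : Prop := exists M : R, forall k i, `|v k i| <= M.

Lemma cvg_bounded (u : nat -> R) (l : R) : u @ \oo --> l ->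
  exists M, forall k, `|u k| <= M.
Proof.
move=> ul; have /cvg_seq_bounded[M [_ HM]] : cvgn u by apply/cvg_ex; exists l.
by exists (M + 1) => k; apply: HM => //; rewrite ltrDl.
Qed.

Lemma vanishes_bounded v : vanishes v -> uniformly_bounded v.
Proof.
move=> v0; have /choice[M HM] : forall i, exists M, forall k, `|v k i| <= M.
  by move=> i; exact: cvg_bounded (v0 i).
exists (\sum_i M i) => k i; apply: le_trans (HM i k) _.
rewrite (bigD1 i)//= lerDl; apply: sumr_ge0 => j _.
exact: le_trans (HM j k).
Qed.

Lemma uniformly_boundedD u v : uniformly_bounded u -> uniformly_bounded v ->
  uniformly_bounded (fun k i => u k i + v k i).
Proof.
move=> [A HA] [B HB]; exists (A + B) => k i.
by apply: le_trans (ler_normD _ _) _; rewrite lerD.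
Qed.

Lemma uniformly_boundedN v : uniformly_bounded v ->
  uniformly_bounded (fun k i => - v k i).
Proof. by move=> [A HA]; exists A => k i; rewrite normrN. Qed.

Lemma vanishes_sqnorm v : vanishes v -> (fun k => sqnorm (v k)) @ \oo --> (0 : R).
Proof.
move=> v0; have -> : (0 : R) = \sum_(i < N) 0 ^+ 2.
  by rewrite big1// => i _; rewrite expr0n.
apply: cvg_sumr => i.
under eq_fun do rewrite expr2.
by rewrite expr2; apply: cvgM; exact: v0.
Qed.

Lemma sqnorm_vanishes v : (fun k => sqnorm (v k)) @ \oo --> (0 : R) -> vanishes v.
Proof.
move=> v0 i; apply/cvgrPdist_le => eps eps0.
have e20 : 0 < eps ^+ 2 by rewrite exprn_gt0.
have /cvgrPdist_le/(_ _ e20)[K _ HK] := v0.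
exists K => // k /HK /=; rewrite !sub0r !normrN ger0_norm ?sqnorm_ge0// => vk.
rewrite -(ler_pXn2r (isT : (0 < 2)%N)) ?nnegrE ?(ltW eps0)// real_normK ?num_real//.
exact: le_trans (sqr_le_sqnorm _ _) vk.
Qed.

Lemma bounded_sqnorm v : uniformly_bounded v ->
  exists M, forall k, sqnorm (v k) <= M.
Proof.
move=> [M HM]; exists (\sum_(i < N) M ^+ 2) => k; apply: ler_sum => i _.
have M0 : 0 <= M := le_trans (normr_ge0 _) (HM k i).
by rewrite -real_normK ?num_real// lerXn2r ?nnegrE.
Qed.

Lemma sqnorm_bounded v (M : R) : (forall k, sqnorm (v k) <= M) ->
  uniformly_bounded v.
Proof.
move=> HM; exists (M + 1) => k i.
have := le_trans (sqr_le_sqnorm (v k) i) (HM k).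
rewrite -real_normK ?num_real//; have := normr_ge0 (v k i); nra.
Qed.

End VectorSequences.

Lemma sqr_cvg0 {R : realType} (u : nat -> R) :
  (fun k => u k ^+ 2) @ \oo --> (0 : R) -> u @ \oo --> (0 : R).
Proof.
move=> u0; have := sqnorm_vanishes (N := 1) (fun k _ => u k).
rewrite (_ : (fun k => sqnorm _) = fun k => u k ^+ 2).
  by move=> /(_ u0 ord0).
by apply/funext => k; rewrite /sqnorm big_ord1.
Qed.

Section NoisyConsensus.
Context {R : realType} {N : nat} {e : rel 'I_N} {L : 'M[R]_N}.
Hypothesis e_connected : connected_graph e.
Hypothesis L_weights : weight_matrix e L.
Local Notation lap := (laplacian L).

Lemma vanishes_laplacian (v : nat -> 'I_N -> R) : vanishes v ->
  vanishes (fun k => lap (v k)).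
Proof.
move=> v0 i; have -> : (0 : R) = \sum_j L i j * (0 - 0).
  by rewrite big1// => j _; rewrite subrr mulr0.
apply: cvg_sumr => j; apply: cvgMr.
by apply: cvgB; exact: v0.
Qed.

Lemma bounded_laplacian (v : nat -> 'I_N -> R) : uniformly_bounded v ->
  uniformly_bounded (fun k => lap (v k)).
Proof.
move=> /bounded_sqnorm[M HM].
have [C C0 HC] := @sqnorm_laplacian_le R N L.
apply: (@sqnorm_bounded _ _ _ (C * M)) => k.
by apply: le_trans (HC _) _; rewrite ler_wpM2l// ltW.
Qed.

Context {gamma : nat -> R} {u b m del : nat -> 'I_N -> R}.
Hypothesis gamma_gt0 : forall k, 0 < gamma k.
Hypothesis gamma_cvg0 : gamma @ \oo --> (0 : R).
Hypothesis u_mean0 : forall k, \sum_i u k i = 0.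
Hypothesis u_step : forall k i, u k.+1 i =
  u k i + gamma k * lap (fun j => u k j + b k j + m k j) i + del k i.
Hypothesis noise_cvg : forall i,
  cvgn (fun n => \sum_(0 <= k < n) gamma k * m k i).

(** The noise m enters through a convergent series: the laplacian of the
    remainder of that series is added to u, which removes m from the recursion
    at the price of a vanishing forcing term. *)
Lemma noise_removal : exists w : nat -> 'I_N -> R, vanishes w /\
  exists c C : R, [/\ 0 < c, 0 < C &
  \forall k \near \oo, c * gamma k <= 1 /\
    sqnorm (fun i => u k.+1 i + lap (w k.+1) i) <=
    (1 - c * gamma k) * sqnorm (fun i => u k i + lap (w k) i)
    + c * gamma k * (C * sqnorm (lap (fun j => b k j - lap (w k) j)))
    + C * c * (sqnorm (del k) / gamma k)].
Proof.
pose S n i := \sum_(0 <= k < n) gamma k * m k i.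
(* w k is the remainder of the noise series *)
pose w n i := limn (S ^~ i) - S n i.
exists w; split.
  move=> i; rewrite -[X in _ --> X](subrr (limn (S ^~ i))).
  by apply: cvgB; [exact: cvg_cst|exact: noise_cvg].
have [c [g0 [C [c0 g00 C0 step]]]] := consensus_step e_connected L_weights.
exists c, (C / c); split => //; first exact: divr_gt0.
have /cvgrPdist_le/(_ _ g00) gs := gamma_cvg0.
near=> k.
have gk : gamma k <= g0.
  apply: le_trans (ler_norm _) _; rewrite -normrN -sub0r.
  by near: k.
have wS i : w k.+1 i = w k i + - gamma k * m k i.
  by rewrite /w /S big_nat_recr//=; ring.
have z0 : \sum_i (u k i + lap (w k) i) = 0.
  by rewrite big_split/= u_mean0 (sum_laplacian L_weights) addr0.
have [cg1 main] := step (gamma k) (fun i => u k i + lap (w k) i)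
  (lap (fun j => b k j - lap (w k) j)) (del k) (gamma_gt0 k) gk z0.
split => //.
have -> : c * gamma k * (C / c * sqnorm (lap (fun j => b k j - lap (w k) j)))
  = C * (gamma k * sqnorm (lap (fun j => b k j - lap (w k) j))).
  by field; rewrite gt_eqF.
rewrite divfK ?gt_eqF//.
apply: le_trans main; rewrite le_eqVlt; apply/orP; left; apply/eqP.
congr sqnorm; apply/funext => i.
have lapB (f g : 'I_N -> R) : lap (fun j => f j - g j) i = lap f i - lap g i.
  rewrite laplacianD; congr (_ + _).
  by rewrite -mulN1r -laplacianZ; congr (lap _ i); apply/funext => j; rewrite mulN1r.
have lapw : lap (w k.+1) i = lap (w k) i - gamma k * lap (m k) i.
  by rewrite (funext wS : w k.+1 = _) laplacianD laplacianZ mulNr.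
by rewrite u_step lapw lapB !laplacianD; ring.
Unshelve. all: by end_near. Qed.

Lemma consensus_cvg : divergent_sums gamma -> vanishes b ->
  vanishing_tails (fun k => sqnorm (del k) / gamma k) -> vanishes u.
Proof.
move=> dg vb vdel; have [w [vw [c [C [c0 C0 rec]]]]] := noise_removal.
pose z k i := u k i + lap (w k) i.
have vz : vanishes z.
  apply: sqnorm_vanishes.
  apply: (@perturbed_contraction_cvg0 R _ (fun k => c * gamma k)
    (fun k => C * sqnorm (lap (fun j => b k j - lap (w k) j)))
    (fun k => C * c * (sqnorm (del k) / gamma k))).
  - by move=> k; exact: sqnorm_ge0.
  - by move=> k; rewrite mulr_ge0// ltW.
  - by move=> k; rewrite !mulr_ge0 ?sqnorm_ge0 ?invr_ge0// ltW.
  - exact: rec.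
  - exact: divergent_sumsZ.
  - rewrite -(mulr0 C); apply: cvgMr.
    apply: vanishes_sqnorm; apply: vanishes_laplacian => j.
    rewrite -[X in _ --> X](subrr 0); apply: cvgB; first exact: vb.
    exact: vanishes_laplacian.
  - by apply: vanishing_tailsZ => //; rewrite mulr_ge0// ltW.
move=> i; have -> : u ^~ i = (fun k => z k i - lap (w k) i).
  by apply/funext => k; rewrite /z addrK.
rewrite -[X in _ --> X](subrr 0); apply: cvgB; first exact: vz.
exact: vanishes_laplacian.
Qed.

Lemma consensus_bounded : uniformly_bounded b -> (forall k i, del k i = 0) ->
  uniformly_bounded u.
Proof.
move=> bb del0; have [w [vw [c [C [c0 C0 rec]]]]] := noise_removal.
pose z k i := u k i + lap (w k) i.
have blw : uniformly_bounded (fun k => lap (w k)).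
  exact/bounded_laplacian/vanishes_bounded.
have /bounded_sqnorm[B HB] :
    uniformly_bounded (fun k => lap (fun j => b k j - lap (w k) j)).
  apply: bounded_laplacian; apply: uniformly_boundedD => //.
  exact: uniformly_boundedN.
have bz : uniformly_bounded z.
  have [|M HM] := @perturbed_contraction_bounded R (fun k => sqnorm (z k))
      (fun k => c * gamma k) (C * B) (fun k => mulr_ge0 (ltW c0) (ltW (gamma_gt0 k))).
    have [K _ HK] := rec; exists K => // k /HK/= [cg1 main].
    split=> //; apply: le_trans main _.
    have -> : sqnorm (del k) = 0.
      by rewrite /sqnorm big1// => i _; rewrite del0 expr0n.
    rewrite mul0r mulr0 addr0 lerD2l ler_pM2l ?mulr_gt0//.
    by rewrite ler_pM2l.
  exact: sqnorm_bounded HM.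
have -> : u = (fun k i => z k i + - lap (w k) i).
  by apply/funext => k; apply/funext => i; rewrite /z addrK.
by apply: uniformly_boundedD => //; exact: uniformly_boundedN.
Qed.

End NoisyConsensus.

(** * Expectations of bounded functions *)

Section BoundedExpectation.
Context {d : measure_display} {T : measurableType d} {R : realType}.
Variable P : probability T R.
Implicit Types (f g X Y : T -> R).

(** Bounded functions are enough for the whole probabilistic part, and make
    every integral below finite. *)
Definition bounded_measurable f : Prop :=
  measurable_fun setT f /\ exists M, forall w, `|f w| <= M.

Definition mean f : R := \int[P]_w f w.

Lemma bounded_measurable_integrable {f} : bounded_measurable f ->
  P.-integrable setT (EFin \o f).
Proof.
move=> [mf [M fM]]; apply: measurable_bounded_integrable => //.
  by rewrite (le_lt_trans (probability_le1 P measurableT))// ltry.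
exists M; split; first exact: num_real.
by move=> x Mx w _; exact: le_trans (fM w) (ltW Mx).
Qed.

Lemma bounded_measurableD {f g} : bounded_measurable f -> bounded_measurable g ->
  bounded_measurable (fun w => f w + g w).
Proof.
move=> [mf [M fM]] [mg [M' gM]]; split; first exact: measurable_funD.
by exists (M + M') => w; apply: le_trans (ler_normD _ _) _; rewrite lerD.
Qed.

Lemma bounded_measurableM {f g} : bounded_measurable f -> bounded_measurable g ->
  bounded_measurable (fun w => f w * g w).
Proof.
move=> [mf [M fM]] [mg [M' gM]]; split; first exact: measurable_funM.
by exists (M * M') => w; rewrite normrM ler_pM.
Qed.

Lemma bounded_measurable_cst (c : R) : bounded_measurable (fun=> c).
Proof. by split; [exact: measurable_cst|exists `|c|]. Qed.

Lemma bounded_measurable_indic {A : set T} : measurable A ->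
  bounded_measurable (\1_A : T -> R).
Proof.
move=> mA; split; first exact: measurable_indic.
by exists 1 => w; rewrite indicE; case: (w \in A); rewrite ?normr1 ?normr0.
Qed.

Lemma bounded_measurable_sum {I : Type} (s : seq I) {F : I -> T -> R} :
  (forall i, bounded_measurable (F i)) ->
  bounded_measurable (fun w => \sum_(i <- s) F i w).
Proof.
move=> bF; elim: s => [|i s IH].
  by under eq_fun do rewrite big_nil; exact: bounded_measurable_cst.
by under eq_fun do rewrite big_cons; exact: bounded_measurableD.
Qed.

Lemma meanD {f g} : bounded_measurable f -> bounded_measurable g ->
  mean (fun w => f w + g w) = mean f + mean g.
Proof.
by move=> bf bg; apply: RintegralD => //; exact: bounded_measurable_integrable.
Qed.

Lemma meanZ (c : R) {f} : bounded_measurable f ->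
  mean (fun w => c * f w) = c * mean f.
Proof.
by move=> bf; apply: RintegralZl => //; exact: bounded_measurable_integrable.
Qed.

Lemma mean_cst (c : R) : mean (fun=> c) = c.
Proof.
have P1 : fine (P setT) = 1 by rewrite probability_setT.
by rewrite /mean Rintegral_cst; [rewrite P1 mulr1|exact: measurableT].
Qed.

Lemma mean_sum {I : Type} (s : seq I) {F : I -> T -> R} :
  (forall i, bounded_measurable (F i)) ->
  mean (fun w => \sum_(i <- s) F i w) = \sum_(i <- s) mean (F i).
Proof.
move=> bF; elim: s => [|i s IH].
  by rewrite big_nil; under eq_fun do rewrite big_nil; exact: mean_cst.
rewrite big_cons -IH; under eq_fun do rewrite big_cons.
by rewrite meanD//; exact: bounded_measurable_sum.
Qed.

Lemma le_mean {f g} : bounded_measurable f -> bounded_measurable g ->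
  (forall w, f w <= g w) -> mean f <= mean g.
Proof.
move=> bf bg fg; apply: le_Rintegral => //; exact: bounded_measurable_integrable.
Qed.

Lemma mean_indic {A : set T} : measurable A -> mean \1_A = fine (P A).
Proof. by move=> mA; rewrite /mean /Rintegral integral_indic// setIT. Qed.

(** X is orthogonal to every bounded variable known at the time of G: such a
    variable is a uniform limit of combinations of indicators of events of G,
    obtained by rounding. *)
Lemma mean_zero_orthogonal {G : set (set T)} {X Y} : G `<=` measurable ->
  bounded_measurable X ->
  (forall A, <<s G >> A -> mean (fun w => \1_A w * X w) = 0) ->
  measurable_fun setT (Y : g_sigma_algebraType G -> R) ->
  (exists B, forall w, `|Y w| <= B) ->
  mean (fun w => Y w * X w) = 0.
Proof.
move=> Gm bX X0 mY [B YB].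
have sGm : <<s G >> `<=` d.-measurable.
  by apply: smallest_sub => //; exact: sigma_algebra_measurable.
have bY : bounded_measurable Y.
  by split; [move=> _ A mA; apply: sGm; exact: mY|exists B].
have [mX [C XC]] := bX.
have C0 : 0 <= C := le_trans (normr_ge0 _) (XC point).
suff bnd (n : nat) : `|mean (fun w => Y w * X w)| <= C / n.+1%:R.
  apply/eqP; rewrite -normr_le0 leNgt; apply/negP => pos.
  set m := `|mean _| in bnd pos.
  pose n := Num.trunc (C / m).
  have /andP[_ nC] := truncn_itv (divr_ge0 C0 (ltW pos)).
  have := bnd n; rewrite leNgt ltr_pdivrMr ?ltr0n// => /negP; apply.
  by move: nC; rewrite ltr_pdivrMr// mulrC.
set h : R := n.+1%:R; have h0 : 0 < h by rewrite ltr0n.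
clearbody h.
(* D j is the event that Y is rounded down to j / h - B; only m of these
   events are possible, since Y lies in [- B, B] *)
pose D (j : nat) : set T := Y @^-1` `[j%:R / h - B, j.+1%:R / h - B[.
have GD j : <<s G >> (D j).
  by rewrite -[D j]setTI; apply: mY => //; exact: measurable_itv.
pose q w := Num.trunc (h * (Y w + B)).
have YB0 w : 0 <= h * (Y w + B).
  by rewrite pmulr_rge0//; have := YB w; rewrite ler_norml => /andP[? _]; lra.
have DE j w : (w \in D j) = (j == q w).
  apply/idP/eqP.
    rewrite inE /D/= in_itv/= => /andP[l1 l2]; apply/esym/truncn_def.
    rewrite mulrC -ler_pdivrMr// -ltr_pdivlMr//.
    by rewrite -lerBlDr l1 -ltrBrDr.
  move=> ->; rewrite inE /D/= in_itv/=.
  have /andP[l1 l2] := truncn_itv (YB0 w).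
  rewrite lerBlDr ltrBrDr ler_pdivrMr// ltr_pdivlMr//.
  by rewrite ![_ * h]mulrC l1 l2.
pose m := (Num.trunc (h * (B + B))).+1.
have qm w : (q w < m)%N.
  rewrite ltnS; apply: le_truncn; rewrite ler_pM2l// lerD2r.
  exact: le_trans (ler_norm _) (YB w).
pose Z w := \sum_(j < m) ((j%:R / h - B) * (\1_(D j) w)).
have ZE w : Z w = (q w)%:R / h - B.
  rewrite /Z (bigD1 (Ordinal (qm w)))//= big1.
    by rewrite indicE DE eqxx mulr1 addr0.
  move=> j jq; rewrite indicE DE; case: eqP => [E|]; last by rewrite mulr0.
  by case/eqP: jq; apply: val_inj.
have bZ : bounded_measurable Z.
  apply: bounded_measurable_sum => j; apply: bounded_measurableM.
    exact: bounded_measurable_cst.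
  by apply: bounded_measurable_indic; exact: sGm.
have ZX0 : mean (fun w => Z w * X w) = 0.
  under eq_fun do rewrite /Z mulr_suml.
  rewrite mean_sum; last first.
    move=> j; apply: bounded_measurableM => //; apply: bounded_measurableM.
      exact: bounded_measurable_cst.
    by apply: bounded_measurable_indic; exact: sGm.
  apply: big1 => j _; under eq_fun do rewrite -mulrA.
  rewrite meanZ; first by rewrite X0// mulr0.
  apply: bounded_measurableM => //.
  by apply: bounded_measurable_indic; exact: sGm.
have YZ w : `|(Y w - Z w) * X w| <= C / h.
  rewrite normrM mulrC; apply: ler_pM => //.
  have /andP[] := truncn_itv (YB0 w); rewrite -/(q w) ZE.
  rewrite -[X in X <= _ -> _](divfK (lt0r_neq0 h0)) mulrC ler_pM2l// => l1.
  rewrite -[X in _ < X -> _](divfK (lt0r_neq0 h0)) [ltRHS]mulrC ltr_pM2l//.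
  rewrite -natr1 mulrDl mul1r => l2.
  by rewrite ler_norml; apply/andP; split; lra.
have -> : mean (fun w => Y w * X w) = mean (fun w => (Y w - Z w) * X w).
  rewrite -[RHS]addr0 -ZX0 -meanD; last 2 first.
  - apply: bounded_measurableM => //; apply: bounded_measurableD => //.
    have -> : (fun w => - Z w) = (fun w => -1 * Z w).
      by apply/funext => w; rewrite mulN1r.
    by apply: bounded_measurableM => //; exact: bounded_measurable_cst.
  - exact: bounded_measurableM.
  by congr mean; apply/funext => w; rewrite mulrBl subrK.
have bYZ : bounded_measurable (fun w => (Y w - Z w) * X w).
  split; last by exists (C / h).
  by apply: measurable_funM => //; apply: measurable_funB; [case: bY|case: bZ].
rewrite ler_norml -[X in - X]mean_cst -[X in _ && (_ <= X)]mean_cst.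
have -> : - mean (fun=> C / h) = mean (fun=> - (C / h)) by rewrite !mean_cst.
apply/andP; split; apply: le_mean => //; try exact: bounded_measurable_cst.
  by move=> w; have := YZ w; rewrite ler_norml => /andP[].
by move=> w; have := YZ w; rewrite ler_norml => /andP[].
Qed.

End BoundedExpectation.

(** * Convergence of square-summable martingales *)

Section MartingaleDifferences.
Context {d : measure_display} {T : measurableType d} {R : realType}.
Variable P : probability T R.
Implicit Types (G : nat -> set (set T)) (X : nat -> T -> R) (C : nat -> R).

(** G k generates the information available before X k is drawn. *)
Definition martingale_differences G X C : Prop :=
  [/\ forall k, G k `<=` d.-measurable,
      forall j k, (j < k)%N ->
        measurable_fun setT (X j : g_sigma_algebraType (G k) -> R),
      forall k w, `|X k w| <= C k &
      forall k A, <<s G k >> A -> mean P (fun w => \1_A w * X k w) = 0].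

Lemma generated_measurable {H : set (set T)} : H `<=` d.-measurable ->
  <<s H >> `<=` d.-measurable.
Proof. by move=> Hm; apply: smallest_sub => //; exact: sigma_algebra_measurable. Qed.

Lemma martingale_differences_bounded {G X C} k :
  martingale_differences G X C -> bounded_measurable (X k).
Proof.
move=> [Gm aX bX _]; split; last by exists (C k) => w; exact: bX.
move=> _ A mA; apply: (generated_measurable (Gm k.+1)).
exact: aX (ltnSn k) _ _ mA.
Qed.

Lemma partial_sum_known {G X C n k} : martingale_differences G X C -> (n <= k)%N ->
  measurable_fun setT
    ((fun w => \sum_(0 <= j < n) X j w) : g_sigma_algebraType (G k) -> R).
Proof.
move=> [_ aX _ _]; elim: n => [|n IH] nk.
  by under eq_fun do rewrite big_nil; exact: measurable_cst.
under eq_fun do rewrite big_nat_recr//=.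
by apply: measurable_funD; [exact: IH (ltnW nk)|exact: aX].
Qed.

(** The increments are orthogonal: their second moments add up. *)
Lemma second_moment {G X C} n : martingale_differences G X C ->
  mean P (fun w => (\sum_(0 <= j < n) X j w) ^+ 2) <= \sum_(0 <= j < n) C j ^+ 2.
Proof.
move=> mX; have [Gm aX bX X0] := mX.
have bS k : bounded_measurable (fun w => \sum_(0 <= j < k) X j w).
  by apply: bounded_measurable_sum => j; exact: martingale_differences_bounded mX.
elim: n => [|n IH].
  under eq_fun do rewrite big_nil expr0n/=.
  by rewrite mean_cst big_nil.
set S := fun w => \sum_(0 <= j < n) X j w.
have bX' := martingale_differences_bounded n mX.
have orth : mean P (fun w => S w * X n w) = 0.
  apply: (mean_zero_orthogonal P (G := G n)) => //.
  - exact: X0.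
  - exact: partial_sum_known mX (leqnn n).
  - by have [_ [B HB]] := bS n; exists B.
have bSS := bounded_measurableM (bS n) (bS n).
have bSX := bounded_measurableM (bS n) bX'.
have bXX := bounded_measurableM bX' bX'.
have -> : mean P (fun w => (\sum_(0 <= j < n.+1) X j w) ^+ 2) =
    mean P (fun w => S w * S w) + 2 * mean P (fun w => S w * X n w) +
    mean P (fun w => X n w * X n w).
  have b2 := bounded_measurableM (bounded_measurable_cst 2) bSX.
  rewrite -meanZ// -meanD// -meanD//; last exact: bounded_measurableD.
  congr mean; apply/funext => w; rewrite big_nat_recr//= -/(S w); ring.
rewrite orth mulr0 addr0 big_nat_recr//=; apply: lerD.
  by apply: le_trans IH; rewrite le_eqVlt; apply/orP; left; apply/eqP.
rewrite -[leRHS](mean_cst P); apply: le_mean => //.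
  exact: bounded_measurable_cst.
move=> w; rewrite -expr2 -real_normK ?num_real//.
have C0 : 0 <= C n := le_trans (normr_ge0 _) (bX n w).
by rewrite lerXn2r ?nnegrE.
Qed.

(** The partial sums up to time k have stayed in ]-eps, eps[. This is decided by
    the variables before X k, so that stopping preserves the martingale
    property. *)
Fixpoint alive (eps : R) X (k : nat) (w : T) : bool :=
  if k is k'.+1 then alive eps X k' w && (`|\sum_(0 <= j < k) X j w| < eps)
  else true.

Lemma alive_known {G X C} eps {k n} : martingale_differences G X C -> (k <= n)%N ->
  measurable_fun setT (alive eps X k : g_sigma_algebraType (G n) -> bool).
Proof.
move=> mX; elim: k => [|k IH] kn; first exact: measurable_cst.
apply: measurable_and; first exact: IH (ltnW kn).
apply: measurable_fun_ltr => //.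
by apply: measurableT_comp => //; exact: partial_sum_known mX kn.
Qed.

Definition stopped eps X (k : nat) (w : T) : R :=
  if alive eps X k w then X k w else 0.

Lemma stopped_differences {G X C} eps : martingale_differences G X C ->
  martingale_differences G (stopped eps X) C.
Proof.
move=> mX; have [Gm aX bX X0] := mX; split => //.
- move=> j k jk; apply: measurable_fun_ifT.
  + exact: alive_known mX (ltnW jk).
  + exact: aX.
  + exact: measurable_cst.
- move=> k w; rewrite /stopped; case: ifP => // _; rewrite normr0.
  exact: le_trans (bX k w).
- move=> k A GA; pose B : set T := A `&` [set w | alive eps X k w].
  rewrite -[RHS](X0 k B); last first.
    have al := alive_known eps mX (leqnn k).
    rewrite /B -[X in A `&` X]setTI.
    apply: (@measurableI _ (g_sigma_algebraType (G k))) => //.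
    exact: al measurableT [set true] _.
  congr mean; apply/funext => w; rewrite /stopped !indicE.
  case: ifP => al.
    congr (_%:R * _); congr nat_of_bool.
    by apply/idP/idP; rewrite !inE /B /=; [move=> ?; split|case].
  have -> : (w \in B) = false by apply/negP; rewrite inE /B/= al => -[].
  by rewrite mulr0 mul0r.
Qed.

(** Once the sum has left ]-eps, eps[ it is frozen at its exit value. *)
Lemma stopped_sum eps X n w :
  if alive eps X n w
  then \sum_(0 <= j < n) stopped eps X j w = \sum_(0 <= j < n) X j w
  else eps <= `|\sum_(0 <= j < n) stopped eps X j w|.
Proof.
elim: n => [|n /=]; first by rewrite /= !big_nil.
case: ifPn => [al IH|al IH] /=; last first.
  by rewrite big_nat_recr//= /stopped (negbTE al) addr0.
have E : \sum_(0 <= j < n.+1) stopped eps X j w = \sum_(0 <= j < n.+1) X j w.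
  by rewrite !big_nat_recr//= IH /stopped al.
by rewrite E; case: ltP.
Qed.

Lemma exit_measurable {G X C} eps n : martingale_differences G X C ->
  measurable [set w | ~~ alive eps X n w].
Proof.
move=> mX; have [Gm _ _ _] := mX; apply: (generated_measurable (Gm n)).
have -> : [set w | ~~ alive eps X n w] = setT `&` alive eps X n @^-1` [set false].
  by apply/seteqP; split=> w; rewrite /= ?setTI/=; [move/negbTE|case=> _ ->].
exact: (alive_known eps mX (leqnn n)).
Qed.

(** Kolmogorov's maximal inequality: stopping the sums when they leave
    ]-eps, eps[ keeps the second moment bound, and the stopped sum remembers
    that an exit took place. *)
Lemma maximal_inequality {G X C} {eps : R} n : martingale_differences G X C -> 0 < eps ->
  (P [set w | ~~ alive eps X n w] <=
   ((\sum_(0 <= j < n) C j ^+ 2) / eps ^+ 2)%:E)%E.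
Proof.
move=> mX eps0; have mY := stopped_differences eps mX.
set B := [set w | _].
have mB : measurable B := exit_measurable eps n mX.
have PBfin : P B \is a fin_num by exact: fin_num_measure.
rewrite -(fineK PBfin) lee_fin ler_pdivlMr ?exprn_gt0// mulrC.
apply: le_trans (second_moment n mY).
rewrite -mean_indic// -meanZ; last exact: bounded_measurable_indic.
have bS : bounded_measurable (fun w => \sum_(0 <= j < n) stopped eps X j w).
  apply: bounded_measurable_sum => j.
  exact: martingale_differences_bounded mY.
apply: le_mean.
- apply: bounded_measurableM; first exact: bounded_measurable_cst.
  exact: bounded_measurable_indic.
- by under eq_fun do rewrite expr2; exact: bounded_measurableM.
move=> w; rewrite indicE; have [wB|wB] := boolP (w \in B); last first.
  by rewrite mulr0 sqr_ge0.
rewrite mulr1 -[leRHS]real_normK ?num_real// lerXn2r ?nnegrE ?(ltW eps0)//.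
have := stopped_sum eps X n w; move: wB; rewrite inE /B/= => /negbTE ->.
by [].
Qed.

(** The bound of the maximal inequality does not depend on the horizon. *)
Lemma exit_probability {G X C} {eps K : R} : martingale_differences G X C -> 0 < eps ->
  (forall n, \sum_(0 <= j < n) C j ^+ 2 <= K) ->
  measurable (\bigcup_n [set w | ~~ alive eps X n w]) /\
  (P (\bigcup_n [set w | ~~ alive eps X n w]) <= (K / eps ^+ 2)%:E)%E.
Proof.
move=> mX eps0 CK.
have mB n : measurable [set w | ~~ alive eps X n w].
  exact: exit_measurable mX.
have mU : measurable (\bigcup_n [set w | ~~ alive eps X n w]).
  exact: bigcupT_measurable.
split=> //.
have hom : {homo (fun n => [set w | ~~ alive eps X n w]) :
    n m / (n <= m)%N >-> (n <= m)%O}.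
  move=> n m nm; rewrite subsetEset => w /= na; apply/negP; move: m nm.
  elim=> [|m IH] nm; first by move: nm na; rewrite leqn0 => /eqP ->.
  move: nm; rewrite leq_eqVlt => /orP[/eqP nm|]; first by move: na; rewrite nm => /negP.
  by rewrite ltnS => /IH /= h /andP[/h].
have cv := @nondecreasing_cvg_mu _ _ _ P _ mB mU hom.
rewrite -(cvg_lim _ cv)//; apply: lime_le; first by apply/cvg_ex; eexists; exact: cv.
apply: nearW => n; apply: le_trans (maximal_inequality n mX eps0) _.
by rewrite lee_fin ler_pM2r// invr_gt0 exprn_gt0.
Qed.

Lemma martingale_differences_shift {G X C} n0 : martingale_differences G X C ->
  martingale_differences (fun k => G (n0 + k)%N) (fun k => X (n0 + k)%N)
    (fun k => C (n0 + k)%N).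
Proof.
move=> [Gm aX bX X0]; split.
- by move=> k; exact: Gm.
- by move=> j k jk; apply: aX; rewrite ltn_add2l.
- by move=> k w; exact: bX.
- by move=> k A; exact: X0.
Qed.

Lemma alive_le {eps X n w} : 0 < eps -> alive eps X n w ->
  `|\sum_(0 <= j < n) X j w| < eps.
Proof. by case: n => [|n] e0 /=; [rewrite big_nil normr0|case/andP]. Qed.

(** Convergence of square-summable martingale series: by the maximal
    inequality the oscillation of the partial sums after n0 exceeds eps with a
    probability that vanishes as n0 grows. *)
Theorem martingale_series_cvg {G X C} : martingale_differences G X C ->
  vanishing_tails (fun k => C k ^+ 2) ->
  {ae P, forall w, cvgn (fun n => \sum_(0 <= k < n) X k w)}.
Proof.
move=> mX vC.
pose E m n0 := \bigcup_n
  [set w | ~~ alive (m.+1%:R^-1) (fun k => X (n0 + k)%N) n w].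
have e0 m : 0 < m.+1%:R^-1 :> R by rewrite invr_gt0 ltr0n.
pose bad := \bigcup_m \bigcap_n0 E m n0.
have bad0 : P.-negligible bad.
  apply: negligible_bigcup => m.
  have mE n0 : measurable (E m n0).
    apply: bigcupT_measurable => n.
    exact: exit_measurable (martingale_differences_shift n0 mX).
  have mI : measurable (\bigcap_n0 E m n0) by exact: bigcapT_measurable.
  apply/negligibleP => //; apply/eqP; rewrite eq_le measure_ge0 andbT.
  apply/lee_addgt0Pr => eps eps0; rewrite add0e.
  have [n0 Hn0] := vC (eps * m.+1%:R^-1 ^+ 2) (mulr_gt0 eps0 (exprn_gt0 2 (e0 m))).
  have tail n : \sum_(0 <= j < n) C (n0 + j)%N ^+ 2 <= eps * m.+1%:R^-1 ^+ 2.
    apply: le_trans (Hn0 n0 (n0 + n)%N (leqnn n0)).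
    rewrite -{2}(add0n n0) big_addn addKn.
    by under [leRHS]eq_bigr do rewrite addnC.
  have [_] := exit_probability
    (martingale_differences_shift n0 mX) (e0 m) tail.
  rewrite mulfK ?gt_eqF ?exprn_gt0//.
  apply: le_trans; apply: le_measure; rewrite ?inE; [exact: mI|exact: mE|].
  by move=> w; apply.
apply: negligibleS bad0 => w /= ncv; apply: contrapT => nbad; apply: ncv.
apply/cauchy_cvgP; apply: cauchy_exP => eps eps0.
pose m := Num.trunc eps^-1.
have me : m.+1%:R^-1 < eps.
  have ei0 : 0 <= eps^-1 by rewrite invr_ge0 ltW.
  have /andP[_ h] := truncn_itv ei0.
  by rewrite invf_plt ?posrE.
have [n0 nE] : exists n0, ~ E m n0 w.
  apply: contrapT => no; apply: nbad; exists m => // n0 _.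
  by apply: contrapT => nE; apply: no; exists n0.
exists (\sum_(0 <= k < n0) X k w); exists n0 => // n /= n0n.
rewrite /ball/= distrC (@big_cat_nat _ _ _ n0 0%N n)//= addrAC subrr add0r.
apply: lt_trans me.
have al : alive m.+1%:R^-1 (fun k => X (n0 + k)%N) (n - n0) w.
  by apply: contrapT => /negP na; apply: nE; exists (n - n0)%N.
have -> : \sum_(n0 <= k < n) X k w = \sum_(0 <= j < n - n0) X (n0 + j)%N w.
  by rewrite -{1}(add0n n0) big_addn; apply: eq_bigr => j _; rewrite addnC.
exact: alive_le al.
Qed.

End MartingaleDifferences.

(** * Stochastic quantization *)

Section PairMeasurability.
Context {d : measure_display} {T : measurableType d} {R : realType}.
Implicit Types (x y : T -> R).

(** An open set of the plane is a countable union of rational boxes. *)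
Lemma measurable_preimage_open_pair x y (O : set (R * R)) :
  measurable_fun setT x -> measurable_fun setT y -> open O ->
  measurable [set w | O (x w, y w)].
Proof.
move=> mx my oO.
pose box (p q r : rat) : set T :=
  x @^-1` `](ratr p - ratr r), (ratr p + ratr r)[ `&`
  y @^-1` `](ratr q - ratr r), (ratr q + ratr r)[.
pose F (p q r : rat) : set T :=
  if asbool (forall u v : R, `|ratr p - u| < ratr r -> `|ratr q - v| < ratr r ->
    O (u, v)) then box p q r else set0.
have mbox p q r : measurable (box p q r).
  by apply: measurableI; rewrite -[X in measurable X]setTI;
     [apply: mx|apply: my] => //; exact: measurable_itv.
rewrite (_ : [set w | _] = \bigcup_p \bigcup_q \bigcup_r F p q r).
  do 3 (apply: bigcupT_measurable_rat => ?).
  by rewrite /F; case: ifP.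
apply/seteqP; split=> [w /= Ow|w [p _ [q _ [r _]]]]; last first.
  rewrite /F; case: asboolP => // H [] /=; rewrite !in_itv/= => /andP[? ?] /andP[? ?].
  by apply: H; rewrite ltr_norml; apply/andP; split; lra.
have /nbhs_ballP[eps /= eps0 HO] : nbhs (x w, y w) O by exact: open_nbhs_nbhs.
have e20 : 0 < eps / 2 by rewrite divr_gt0.
have [r] := rat_in_itvoo e20; rewrite in_itv/= => /andP[r0 re].
have hx : x w - ratr r < x w + ratr r by lra.
have hy : y w - ratr r < y w + ratr r by lra.
have [p] := rat_in_itvoo hx; rewrite in_itv/= => /andP[p1 p2].
have [q] := rat_in_itvoo hy; rewrite in_itv/= => /andP[q1 q2].
exists p => //; exists q => //; exists r => //; rewrite /F.
case: asboolP => [_|[]].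
  by split; rewrite /= in_itv/=; apply/andP; split; lra.
move=> u v; rewrite !ltr_norml => /andP[? ?] /andP[? ?].
by apply: HO; split; rewrite /= /ball/= ltr_norml; apply/andP; split; lra.
Qed.

(** Continuity on A suffices: preimages of open sets are traces on A of open sets
    of the plane. *)
Lemma measurable_within_continuous_pair {x y} (A : set (R * R)) {g : R * R -> R} :
  measurable_fun setT x -> measurable_fun setT y ->
  (forall w, A (x w, y w)) -> {within A, continuous g} ->
  measurable_fun setT (fun w => g (x w, y w)).
Proof.
move=> mx my xyA /continuousP cg.
apply: (measurability _ (RGenOpens.measurableE R)).
move=> _ [_ [a [b ->] <-]]; rewrite setTI.
have /open_subspaceP[V oV VA] := cg _ (@interval_open _ (BRight a) (BLeft b) isT isT).
rewrite (_ : _ @^-1` _ = [set w | V (x w, y w)]).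
  exact: measurable_preimage_open_pair.
have VE w : V (x w, y w) = (g (x w, y w) \in `]a, b[) :> Prop.
  have := congr1 (fun B => B (x w, y w)) VA; rewrite /setI/= => E.
  apply/propext; split=> [Vw|gw].
    by have : V (x w, y w) /\ A (x w, y w) by []; rewrite E => -[].
  by have [] : V (x w, y w) /\ A (x w, y w) by rewrite E; split.
by apply/seteqP; split=> w /=; rewrite VE.
Qed.

End PairMeasurability.

Section Quantizer.
Context {disp : measure_display} {S : measurableType disp} {R : realType}.
Variable P : probability S R.

Lemma mean_indicM (A : set S) (f : S -> R) :
  mean P (fun w => \1_A w * f w) = \int[P]_(w in A) f w.
Proof.
rewrite /mean [RHS]Rintegral_mkcond patch_indic; congr (Rintegral _ _ _).
by apply/funext => w /=; rewrite mulrC.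
Qed.

Lemma mean_null {N : set S} {f : S -> R} : measurable N -> P N = 0%E ->
  bounded_measurable f -> (forall w, ~ N w -> f w = 0) -> mean P f = 0.
Proof.
move=> mN N0 bf f0; have [_ [M fM]] := bf.
have bK (K : R) : bounded_measurable (fun w => K * \1_N w).
  apply: bounded_measurableM; first exact: bounded_measurable_cst.
  exact: bounded_measurable_indic.
have mK (K : R) : mean P (fun w => K * \1_N w) = 0.
  rewrite meanZ; last exact: bounded_measurable_indic.
  by rewrite mean_indic// N0 mulr0.
have fK w : - M * \1_N w <= f w <= M * \1_N w.
  rewrite indicE; have [wN|wN] := boolP (w \in N).
    by rewrite !mulr1 -ler_norml.
  by rewrite !mulr0 f0 ?lexx//; move: wN; rewrite notin_setE.
apply/eqP; rewrite eq_le -{1}(mK M) -(mK (- M)).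
by apply/andP; split; apply: le_mean => // w; have /andP[] := fK w.
Qed.

Context {d : R} {G : set (set S)} {D : S -> bool} {v w : S -> R}.
Hypothesis d_gt0 : 0 < d.
Hypothesis G_measurable : G `<=` measurable.
Hypothesis D_known :
  measurable_fun setT (D : g_sigma_algebraType G -> bool).
Hypothesis v_known : measurable_fun setT (v : g_sigma_algebraType G -> R).
Hypothesis w_measurable : measurable_fun setT w.
Hypothesis w_quantizes :
  stochastic_quantization P d <<s G >> [set s | D s] v w.

(** The error is at most d almost surely; cutting off larger values changes a
    null event only and makes the error bounded everywhere. *)
Definition quantization_error (s : S) : R :=
  if D s && (`|w s - v s| <= d) then w s - v s else 0.

(** Half-open cells partition the inputs, while the law of the output is
    prescribed on closed cells. *)
Definition quantization_cell (n : int) : set S :=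
  [set s | D s] `&` v @^-1` `[n%:~R * d, (n + 1)%:~R * d[.

Let known_measurable : <<s G >> `<=` disp.-measurable :=
  generated_measurable G_measurable.

Let v_measurable : measurable_fun setT v.
Proof. by move=> _ A mA; apply: known_measurable; exact: v_known. Qed.

Let large_error_measurable : measurable [set s | d < `|w s - v s|].
Proof.
have m1 : measurable_fun setT (fun s => `|w s - v s|).
  by apply: measurableT_comp => //; exact: measurable_funB.
rewrite (_ : [set s | _] =
    setT `&` (fun s => `|w s - v s|) @^-1` `]d, +oo[%classic).
  exact: m1 measurableT _ (measurable_itv _).
by apply/seteqP; split=> s /=; rewrite in_itv/= andbT //; case.
Qed.

Lemma cell_known n : <<s G >> (quantization_cell n).
Proof.
apply: (@measurableI _ (g_sigma_algebraType G)).
  by rewrite -[X in measurable X]setTI; exact: D_known measurableT [set true] _.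
by rewrite -[X in measurable X]setTI; apply: v_known => //; exact: measurable_itv.
Qed.

Lemma quantization_error_bounded_measurable :
  bounded_measurable quantization_error.
Proof.
have mD : measurable_fun setT D.
  by move=> _ A mA; apply: known_measurable; exact: D_known.
have mwv : measurable_fun setT (fun s => w s - v s) by exact: measurable_funB.
split; last first.
  exists d => s; rewrite /quantization_error; case: ifP => [/andP[]//|_].
  by rewrite normr0 ltW.
apply: measurable_fun_ifT => //.
apply: measurable_and => //; apply: measurable_fun_ler => //.
exact: measurableT_comp.
Qed.

(** On a part of a cell the output takes the two ends of the cell, with the
    probabilities that make its mean equal to the input. *)
Lemma quantization_cell_error (n : int) {B : set S} :
  <<s G >> B -> B `<=` quantization_cell n ->
  P (B `&` [set s | d < `|w s - v s|]) = 0%E /\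
  mean P (fun s => \1_B s * quantization_error s) = 0.
Proof.
move=> GB Bcell; pose p s := (v s - n%:~R * d) / d.
have mB : measurable B := known_measurable _ GB.
have BD : B `<=` [set s | D s] by move=> s /Bcell[].
have Bv s : B s -> n%:~R * d <= v s <= (n + 1)%:~R * d.
  by move=> /Bcell[_] /=; rewrite in_itv/= => /andP[-> /ltW ->].
have p01 s : B s -> 0 <= p s <= 1.
  move=> /Bv /andP[l1 l2]; rewrite /p divr_ge0 ?subr_ge0 ?(ltW d_gt0)//=.
  by rewrite ler_pdivrMr// mul1r lerBlDr; move: l2; rewrite intrD mulrDl mul1r addrC.
have vp s : v s = n%:~R * d + d * p s.
  by rewrite /p mulrCA divff ?gt_eqF// mulr1; ring.
have [E0 E1] := w_quantizes n B GB BD Bv.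
(* conditionally on B the output is the lower end W0 with probability 1 - p and
   the upper end W1 with probability p, which leaves a null event N *)
pose W0 := B `&` [set s | w s = n%:~R * d].
pose W1 := B `&` [set s | w s = (n + 1)%:~R * d].
have mW (c : R) : measurable (B `&` [set s | w s = c]).
  apply: measurableI => //; rewrite -[X in measurable X]setTI.
  exact: w_measurable measurableT [set c] (measurable_set1 c).
have bp : bounded_measurable (fun s => \1_B s * p s).
  split; last first.
    exists 1 => s; rewrite indicE; have [sB|_] := boolP (s \in B); last first.
      by rewrite mul0r normr0.
    by rewrite mul1r; move: sB; rewrite inE => /p01 /andP[? ?]; rewrite ger0_norm.
  apply: measurable_funM; first exact: measurable_indic.
  apply: measurable_funM; last exact: measurable_cst.
  by apply: measurable_funB => //; exact: measurable_cst.
have bB : bounded_measurable (\1_B : S -> R) by exact: bounded_measurable_indic.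
have bW0 : bounded_measurable (\1_W0 : S -> R).
  by apply: bounded_measurable_indic; exact: mW.
have bW1 : bounded_measurable (\1_W1 : S -> R).
  by apply: bounded_measurable_indic; exact: mW.
have bZ (c : R) (f : S -> R) : bounded_measurable f ->
    bounded_measurable (fun s => c * f s).
  by apply: bounded_measurableM; exact: bounded_measurable_cst.
have M1 : mean P \1_W1 = mean P (fun s => \1_B s * p s).
  by rewrite mean_indic ?mean_indicM ?E1//; exact: mW.
have M0 : mean P \1_W0 = mean P \1_B - mean P (fun s => \1_B s * p s).
  have -> : mean P \1_B - mean P (fun s => \1_B s * p s) =
      mean P (fun s => \1_B s * (1 - p s)).
    rewrite -mulN1r -meanZ// -meanD//; last exact: bZ.
    by congr mean; apply/funext => s; ring.
  by rewrite mean_indic ?mean_indicM ?E0//; exact: mW.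
pose N := B `\` (W0 `|` W1).
have mN : measurable N.
  by apply: measurableD => //; apply: measurableU; exact: mW.
have n1 : n%:~R * d <> (n + 1)%:~R * d.
  by rewrite intrD mulrDl mul1r; move: d_gt0; lra.
have PN : P N = 0%E.
  have : mean P \1_N = 0.
    have -> : \1_N = (fun s => \1_B s + (-1 * \1_W0 s + -1 * \1_W1 s)) :> (S -> R).
      apply/funext => s; rewrite !indicE /N /W0 /W1.
      rewrite in_setD in_setU !in_setI.
      case: (s \in B) => /=; last ring.
      case: (boolP (s \in [set s | w s = _])) => s0; case: (boolP (s \in _)) => s1 /=; try ring.
      by exfalso; apply: n1; move: s0 s1; rewrite !inE/= => -> .
    have b0 := bZ (-1) _ bW0; have b1 := bZ (-1) _ bW1.
    have b01 := bounded_measurableD b0 b1.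
    rewrite (meanD P bB b01) (meanD P b0 b1) !meanZ//.
    by rewrite M0 M1; ring.
  rewrite mean_indic// => fN.
  by rewrite -[LHS]fineK ?fin_num_measure// fN.
have WE s : B s -> ~ N s -> w s - v s = d * (\1_W1 s - p s) /\ `|w s - v s| <= d.
  move=> Bs nN; have /andP[p0 p1] := p01 s Bs.
  have [ws|ws] : w s = n%:~R * d \/ w s = (n + 1)%:~R * d.
  - apply: contrapT => /not_orP[h0 h1]; apply: nN; split => //.
    by case=> -[_]; [exact: h0|exact: h1].
  - have -> : \1_W1 s = 0 :> R.
      by rewrite indicE memNset// => -[_ /=]; rewrite ws; exact: n1.
    have e1 : w s - v s = d * (0 - p s) by rewrite ws vp; ring.
    split=> //; rewrite e1 sub0r mulrN normrN ger0_norm; last by rewrite mulr_ge0// ltW.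
    by rewrite ler_piMr// ltW.
  - have -> : \1_W1 s = 1 :> R by rewrite indicE mem_set.
    have e1 : w s - v s = d * (1 - p s) by rewrite ws vp intrD; ring.
    split=> //; rewrite e1 ger0_norm; last by rewrite mulr_ge0 ?subr_ge0// ltW.
    by rewrite ler_piMr ?(ltW d_gt0)//; lra.
split.
  apply: (@subset_measure0 _ _ _ P _ N) => //.
  - exact: measurableI.
  - move=> s [Bs /= ds]; apply: contrapT => /(WE s Bs)[_].
    by rewrite leNgt ds.
have be := quantization_error_bounded_measurable.
have bBe := bounded_measurableM bB be.
(* off N the error is d (1_W1 - p), of mean zero *)
pose g s := d * \1_W1 s + (- d) * (\1_B s * p s).
have bg : bounded_measurable g.
  exact: bounded_measurableD (bZ d _ bW1) (bZ (- d) _ bp).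
have g0 : mean P g = 0.
  by rewrite (meanD P (bZ d _ bW1) (bZ (- d) _ bp)) !meanZ// M1; ring.
have : mean P (fun s => \1_B s * quantization_error s + -1 * g s) = 0.
  apply: (mean_null (N := N)) => //.
    exact: bounded_measurableD bBe (bZ (-1) _ bg).
  move=> s nN; have [sB|sB] := pselect (B s); last first.
    have W10 : \1_W1 s = 0 :> R by rewrite indicE memNset// => -[].
    have B0 : \1_B s = 0 :> R by rewrite indicE memNset.
    by rewrite /g W10 B0; ring.
  have [e1 e2] := WE s sB nN.
  have B1 : \1_B s = 1 :> R by rewrite indicE mem_set.
  by rewrite /g B1 /quantization_error (BD s sB) e2 /= e1; ring.
by rewrite (meanD P bBe (bZ (-1) _ bg)) meanZ// g0 mulr0 addr0.
Qed.

Lemma cell_of_input (s : S) : D s ->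
  quantization_cell (Num.floor (v s / d)) s.
Proof.
move=> Ds; split=> //=; rewrite in_itv/=.
have /andP[l1 l2] := floor_itv (v s / d).
by rewrite -ler_pdivlMr// -ltr_pdivrMr// l1 l2.
Qed.

Lemma quantization_error_le :
  P.-negligible [set s | D s /\ d < `|w s - v s|].
Proof.
pose F k := if pickle_inv k is Some n
  then quantization_cell n `&` [set s | d < `|w s - v s|] else set0.
apply: (@negligibleS _ _ _ _ (\bigcup_k F k)).
  move=> s [Ds ds]; exists (pickle (Num.floor (v s / d))); first by [].
  by rewrite /F pickleK_inv; split; [exact: cell_of_input|].
apply: negligible_bigcup => k; rewrite /F.
case: (pickle_inv k) => [n|]; last exact: negligible_set0.
have [P0 _] := quantization_cell_error n (cell_known n) (fun _ x => x).
apply/negligibleP => //; apply: measurableI => //.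
exact: known_measurable (cell_known n).
Qed.

(** The quantizer is unbiased given the past: the cells, of which there are
    countably many, contribute nothing. *)
Lemma quantization_unbiased (A : set S) : <<s G >> A ->
  mean P (fun s => \1_A s * quantization_error s) = 0.
Proof.
move=> GA; pose F k := if pickle_inv k is Some n
  then A `&` quantization_cell n else set0.
have GF k : <<s G >> (F k).
  rewrite /F; case: pickle_inv => [n|]; last exact: (@measurable0 _ (g_sigma_algebraType G)).
  by apply: (@measurableI _ (g_sigma_algebraType G)) => //; exact: cell_known.
have mF k : measurable (F k) := known_measurable _ (GF k).
have be := quantization_error_bounded_measurable.
have UF : \bigcup_k F k = A `&` [set s | D s].
  apply/seteqP; split=> s.
    by move=> [k _]; rewrite /F; case: pickle_inv => // n [As [Ds _]].
  move=> [As Ds]; exists (pickle (Num.floor (v s / d))); first by [].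
  by rewrite /F pickleK_inv; split; [|exact: cell_of_input].
have -> : mean P (fun s => \1_A s * quantization_error s) =
    \int[P]_(s in \bigcup_k F k) quantization_error s.
  rewrite -mean_indicM UF; congr mean; apply/funext => s.
  rewrite /quantization_error !indicE in_setI; case Ds: (D s) => /=.
    by rewrite [s \in [set _ | _]]mem_set// andbT.
  by rewrite [s \in [set _ | _]]memNset/= ?Ds// andbF mulr0 mul0r.
rewrite /Rintegral integral_bigcup//.
- rewrite eseries0// => k _ _.
  have mk := integrable_fin_num (mF k) (integrableS measurableT (mF k) (@subsetT _ _)
    (bounded_measurable_integrable P be)).
  rewrite -[LHS]fineK//; congr EFin.
  transitivity (mean P (fun s => \1_(F k) s * quantization_error s)).
    by rewrite mean_indicM.
  have := GF k; rewrite /F; case: (pickle_inv k) => [n|] GFk.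
    by have [] := quantization_cell_error n GFk (@subIsetr _ _ _).
  by rewrite mean_indicM Rintegral_set0.
- move=> i j _ _ [s []]; rewrite /F.
  have floorE n : v s \in `[n%:~R * d, (n + 1)%:~R * d[ -> Num.floor (v s / d) = n.
    rewrite in_itv/= => /andP[l1 l2]; apply: floor_def.
    by rewrite ler_pdivlMr// ltr_pdivrMr// l1 l2.
  have := @pickle_invK int i; case: pickle_inv => [n /= <- [_ [_ /floorE <-]]|//].
  by have := @pickle_invK int j; case: pickle_inv => [m /= <- [_ [_ /floorE <-]]|//].
- apply: integrableS (bounded_measurable_integrable P be) => //.
  exact: bigcupT_measurable.
Qed.

End Quantizer.

Arguments quantization_error {disp S R} d D v w s.
Arguments quantization_cell {disp S R} d D v n.

(** * Projection onto a segment *)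

Section Interval.
Context {R : realType}.
Implicit Types (A : set R).

Definition closed_segment A (a b : R) : Prop := forall z, A z <-> a <= z <= b.

Lemma convex_compact_segment {A} : compact A -> convex_set (A : set R^o) ->
  A !=set0 -> exists a b, closed_segment A a b.
Proof.
move=> cA vA A0.
have cid : {within A, continuous (id : R -> R)}.
  by apply: continuous_subspaceT => x; exact: cvg_id.
have [a aA amin] := compact_EVT_min A0 cA cid.
have [b bA bmax] := compact_EVT_max A0 cA cid.
exists a, b => z; split=> [Az|/andP[az zb]].
  by rewrite amin ?bmax// inE.
have [ab|ba] := ltP a b; last first.
  by have -> : z = a by [lra]; move: aA; rewrite inE.
have t0 : 0 <= (b - z) / (b - a) by rewrite divr_ge0// subr_ge0// ltW.
have t1 : (b - z) / (b - a) <= 1 by rewrite ler_pdivrMr ?subr_gt0// mul1r; lra.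
have <- : (b - z) / (b - a) * a + (1 - (b - z) / (b - a)) * b = z.
  by field; rewrite subr_eq0 gt_eqF.
by have := vA a b (Itv01 t0 t1) aA bA; rewrite inE.
Qed.

Lemma is_proj_clamp {A} {a b v p : R} : closed_segment A a b -> is_proj A v p ->
  p = Num.max a (Num.min v b).
Proof.
move=> Aab [/Aab /andP[ap pb] pmin].
have ab := le_trans ap pb.
have := pmin (Num.max a (Num.min v b)).
have -> : A (Num.max a (Num.min v b)) = True.
  by apply/propext; split => // _; apply/Aab; rewrite le_max lexx/= ge_max ab ge_min lexx orbT.
move=> /(_ I).
have [vb|bv] := leP v b; have [av|va] := leP a _.
- by rewrite subrr normr0 normr_le0 subr_eq0 => /eqP.
- by rewrite !ltr0_norm ?subr_lt0 //; lra.
- by rewrite !ger0_norm ?subr_ge0; lra.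
- by lra.
Qed.

Lemma clamp_between (a b v : R) : a <= b -> a <= Num.max a (Num.min v b) <= b.
Proof. by move=> ab; rewrite le_max lexx/= ge_max ab ge_min lexx orbT. Qed.

Lemma is_proj_sqr_le {A} {a b v p z : R} : closed_segment A a b -> is_proj A v p ->
  A z -> (p - z) ^+ 2 <= (v - z) ^+ 2.
Proof.
move=> Aab pv /Aab /andP[az zb]; rewrite (is_proj_clamp Aab pv).
have [vb|bv] := leP v b; have [av|va] := leP a _ => //; nra.
Qed.

Lemma is_proj_dist_le {A} {a b v p z : R} : closed_segment A a b -> is_proj A v p ->
  A z -> `|p - z| <= `|v - z|.
Proof.
move=> Aab pv Az; have := is_proj_sqr_le Aab pv Az.
rewrite -[(p - z) ^+ 2]real_normK ?num_real// -[(v - z) ^+ 2]real_normK ?num_real//.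
by rewrite ler_pXn2r ?nnegrE.
Qed.

Lemma clamp_is_proj A a b v : closed_segment A a b -> a <= b ->
  is_proj A v (Num.max a (Num.min v b)).
Proof.
move=> Aab ab; split; first exact/Aab/clamp_between.
move=> z /Aab /andP[az zb].
have [vb|bv] := leP v b; have [av|va] := leP a _.
- by rewrite subrr normr0.
- by rewrite !ltr0_norm ?subr_lt0//; lra.
- by rewrite !ger0_norm ?subr_ge0; lra.
- lra.
Qed.

End Interval.

(** * Randomness in the algorithm *)

Section RunNoise.
Context {R : realType} {N : nat} {disp : measure_display}
  {S : measurableType disp} {P : probability S R}.
Context {Om : 'I_N -> set R} {lo hi : 'I_N -> R} {G : 'I_N -> R * R -> R}
  {L : 'M[R]_N} {sigma c a d : R} {a_lt1 : a < 1} {lambda gamma : nat -> R}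
  {x0 : 'I_N -> R} {xi : 'I_N -> nat -> {RV P >-> R}}
  {x y : 'I_N -> nat -> S -> R} {yt : 'I_N -> nat -> {RV P >-> R}}
  {trig : 'I_N -> nat -> S -> bool} {tau : 'I_N -> nat -> S -> nat}.
Hypothesis Om_segment : forall i, closed_segment (Om i) (lo i) (hi i).
Hypothesis x0_Om : profiles Om x0.
Hypothesis G_continuous : forall i,
  {within Om i `*` [set: R], continuous (G i)}.
Hypothesis run : algorithm_run Om G L sigma c d a_lt1 lambda gamma x0
  xi x y yt trig tau.

Lemma run_x_Om i k w : Om i (x i k w).
Proof.
case: k => [|k]; first by rewrite (run_x0 run); exact: x0_Om.
by have [] := run_x run i k w.
Qed.

(** A player holds its last broadcast value between two triggering times, so
    that the trigger compares y with the current value of yt. *)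
Lemma run_last_broadcast i k w : yt i (tau i k w) w = yt i k w.
Proof.
elim: k => [|k IH]; first by rewrite (run_tau0 run).
rewrite (run_tauS run); case: ifPn => // ntrig.
by rewrite IH (run_hold run).
Qed.

(** Generators of the history at iteration k. *)
Definition past_events (k : nat) : set (set S) :=
  [set A | exists i j (B : set R), measurable B /\
         ((j <= k)%N /\ A = xi i j @^-1` B \/
          (j < k)%N /\ A = yt i j @^-1` B)].

Definition known (k : nat) (X : S -> R) : Prop :=
  measurable_fun setT (X : g_sigma_algebraType (past_events k) -> R).

Lemma past_events_measurable k : past_events k `<=` measurable.
Proof.
move=> _ [i [j [B [mB [[_ ->]|[_ ->]]]]]]; rewrite -[X in measurable X]setTI.
  exact: (measurable_funP (xi i j)).
exact: (measurable_funP (yt i j)).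
Qed.

Lemma trigger_variable_known i j k : (j <= k)%N -> known k (xi i j).
Proof.
move=> jk _ B mB; rewrite setTI; apply: sub_sigma_algebra.
by exists i, j, B; split => //; left.
Qed.

Lemma broadcast_known i j k : (j < k)%N -> known k (yt i j).
Proof.
move=> jk _ B mB; rewrite setTI; apply: sub_sigma_algebra.
by exists i, j, B; split => //; right.
Qed.

(** Decisions and estimates are functions of the past broadcasts. *)
Lemma state_known j : forall k, (j <= k)%N ->
  forall i, known k (x i j) /\ known k (y i j).
Proof.
elim: j => [|j IH] k jk i.
  have xE : x i 0%N = cst (x0 i) by apply/funext => w; rewrite (run_x0 run).
  have yE : y i 0%N = cst (x0 i).
    by apply/funext => w; rewrite (run_y0 run) (run_x0 run).
  by rewrite /known xE yE; split; exact: measurable_cst.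
have st i' := IH k (ltnW jk) i'.
have kG : known k (fun w => G i (x i j w, y i j w)).
  apply: (measurable_within_continuous_pair (Om i `*` [set: R])
    (st i).1 (st i).2) => // w; split => //; exact: run_x_Om.
have kx : known k (x i j.+1).
  have -> : x i j.+1 = fun w => Num.max (lo i)
      (Num.min (x i j w - lambda j * G i (x i j w, y i j w)) (hi i)).
    apply/funext => w.
    exact: is_proj_clamp (Om_segment i) (run_x run i j w).
  apply: measurable_maxr; first exact: measurable_cst.
  apply: measurable_minr; last exact: measurable_cst.
  apply: measurable_funB; first exact: (st i).1.
  by apply: measurable_funM; [exact: measurable_cst|exact: kG].
split=> //.
have -> : y i j.+1 = fun w => y i j w +
    gamma j * (\sum_(l | 0 < L i l) L i l * (yt l j w - yt i j w))
    + x i j.+1 w - x i j w.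
  by apply/funext => w; rewrite (run_y run).
apply: measurable_funB; last exact: (st i).1.
apply: measurable_funD; last exact: kx.
apply: measurable_funD; first exact: (st i).2.
apply: measurable_funM; first exact: measurable_cst.
under eq_fun do rewrite -big_filter.
apply: measurable_sum => l; apply: measurable_funM; first exact: measurable_cst.
by apply: measurable_funB; exact: broadcast_known.
Qed.

Lemma trigger_known i j k : (j <= k)%N ->
  measurable_fun setT (trig i j : g_sigma_algebraType (past_events k) -> bool).
Proof.
case: j => [|j] jk.
  have -> : trig i 0%N = cst true by apply/funext => w; rewrite (run_trig0 run).
  exact: measurable_cst.
have -> : trig i j.+1 = fun w =>
    (sigma * expR (- c * (yt i j w - y i j.+1 w) ^+ 2 / gamma j.+1)
      < xi i j.+1 w).
  by apply/funext => w; rewrite (run_trigS run) run_last_broadcast.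
apply: measurable_fun_ltr; last exact: trigger_variable_known.
apply: measurable_funM; first exact: measurable_cst.
apply: measurableT_comp; first exact: measurable_expR.
apply: measurable_funM; last exact: measurable_cst.
apply: measurable_funM; first exact: measurable_cst.
apply: measurable_funX; apply: measurable_funB; first exact: broadcast_known.
by have [] := state_known j.+1 k jk i.
Qed.

(** The error of a broadcast value is split because its parts are harmless for
    different reasons: at triggering times it has mean zero given the past, at
    the other times it is small. *)
Definition noise i k w : R := if trig i k w then yt i k w - y i k w else 0.

Definition bias i k w : R := if trig i k w then 0 else yt i k w - y i k w.

Lemma broadcastE i k w : yt i k w = y i k w + bias i k w + noise i k w.
Proof. by rewrite /bias /noise; case: ifP => _; ring. Qed.

Hypothesis d_gt0 : 0 < d.
Hypothesis gamma_gt0 : forall k, 0 < gamma k.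

Let err i k := quantization_error d (trig i k) (y i k) (yt i k).

Lemma run_quantization i k : stochastic_quantization P d <<s past_events k >>
  [set w | trig i k w] (y i k) (yt i k).
Proof. exact: (run_quantize run). Qed.

Lemma noise_martingale i : martingale_differences P past_events
  (fun k w => gamma k * err i k w) (fun k => gamma k * d).
Proof.
split.
- exact: past_events_measurable.
- move=> j k jk; apply: measurable_funM; first exact: measurable_cst.
  have kyt := broadcast_known i j k jk.
  have ky := (state_known j k (ltnW jk) i).2.
  have ke : known k (fun w => yt i j w - y i j w) by exact: measurable_funB.
  apply: measurable_fun_ifT => //.
  apply: measurable_and; first exact: trigger_known (ltnW jk).
  apply: measurable_fun_ler => //.
  exact: measurableT_comp.
- move=> k w; rewrite normrM gtr0_norm// ler_pM2l// /err /quantization_error.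
  by case: ifP => [/andP[]//|_]; rewrite normr0 ltW.
- move=> k A GA.
  have bA : bounded_measurable (\1_A : S -> R).
    apply: bounded_measurable_indic.
    exact: generated_measurable (past_events_measurable k) _ GA.
  have tk := trigger_known i k k (leqnn k).
  have yk := (state_known k k (leqnn k) i).2.
  have me := quantization_error_bounded_measurable d_gt0
    (past_events_measurable k) tk yk (measurable_funP (yt i k)).
  have E : (fun w => \1_A w * (gamma k * err i k w)) =
      (fun w => gamma k * (\1_A w * err i k w)).
    by apply/funext => w; ring.
  rewrite E meanZ; last exact: bounded_measurableM.
  rewrite (quantization_unbiased P d_gt0 (past_events_measurable k) tk yk
    (measurable_funP (yt i k)) (run_quantization i k) _ GA).
  by rewrite mulr0.
Qed.

(** The truncated errors form a martingale with steps at most gamma k * d, whose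
    squares are summable; the truncation is almost surely never active. *)
Lemma noise_series_cvg : vanishing_tails (fun k => gamma k ^+ 2) ->
  {ae P, forall w, forall i,
    cvgn (fun n => \sum_(0 <= k < n) gamma k * noise i k w)}.
Proof.
move=> vg.
have vC : vanishing_tails (fun k => (gamma k * d) ^+ 2).
  have -> : (fun k => (gamma k * d) ^+ 2) = (fun k => d ^+ 2 * gamma k ^+ 2).
    by apply/funext => k; ring.
  by apply: vanishing_tailsZ => //; rewrite sqr_ge0.
have ce i := martingale_series_cvg _ (noise_martingale i) vC.
have large i k : P.-negligible
    [set w | trig i k w /\ d < `|yt i k w - y i k w|].
  apply: (quantization_error_le P d_gt0 (past_events_measurable k)).
  - exact: trigger_known.
  - exact: (state_known k k (leqnn k) i).2.
  - exact: (measurable_funP (yt i k)).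
  - exact: run_quantization.
have small i : {ae P, forall w, forall k,
    trig i k w -> `|yt i k w - y i k w| <= d}.
  apply/ae_foralln => k; apply: negligibleS (large i k) => w /=.
  by move/not_implyP => [tr /negP]; rewrite -ltNge.
have : {ae P, forall w, forall i,
    cvgn (fun n => \sum_(0 <= k < n) gamma k * err i k w) /\
    forall k, trig i k w -> `|yt i k w - y i k w| <= d}.
  by apply: filter_forall => i; apply: filterI; [exact: ce|exact: small].
apply: filterS => w H i; have [cv sm] := H i.
have E k : noise i k w = err i k w.
  rewrite /noise /err /quantization_error.
  by case: (boolP (trig i k w)) => //= tr; rewrite sm.
by under eq_fun do under eq_bigr do rewrite E.
Qed.

(** A player stays silent only if xi is at most the threshold, and xi is larger
    than a: this bounds the outdated part by the square root of gamma. *)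
Lemma bias_le (k : nat) i w : 0 < c -> 0 < a -> 0 < sigma ->
  bias i k w ^+ 2 <= gamma k * `|(ln sigma - ln a) / c|.
Proof.
move=> c0 a0 s0; rewrite /bias; case: k => [|k].
  by rewrite (run_trig0 run) expr0n/= mulr_ge0// ltW.
case: ifPn => [_|ntrig]; first by rewrite expr0n/= mulr_ge0// ltW.
move: (ntrig); rewrite (run_trigS run) run_last_broadcast -(run_hold run ntrig).
rewrite -leNgt => le.
have [/(_ k.+1 w)/andP[ax _] _ _ _] := run_xi run i.
move: (lt_le_trans ax le); set r := yt i k.+1 w - y i k.+1 w.
rewrite -ltr_ln ?posrE ?mulr_gt0 ?expR_gt0// lnM ?posrE ?expR_gt0// expRK => h.
have : c * r ^+ 2 / gamma k.+1 <= ln sigma - ln a.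
  by move: h; rewrite !mulNr; lra.
rewrite ler_pdivrMr// => h2.
apply: (@le_trans _ _ (gamma k.+1 * ((ln sigma - ln a) / c))).
  by rewrite mulrA ler_pdivlMr// mulrC; lra.
by rewrite ler_pM2l// ler_norm.
Qed.

End RunNoise.

Arguments noise {R N disp S P} y yt trig i k w.
Arguments bias {R N disp S P} y yt trig i k w.

(** * Consensus of the estimates *)

Section Evaluation.
Context {R : realType} {N : nat}.
Context {Om : 'I_N -> set R} {lo hi : 'I_N -> R} {G : 'I_N -> R * R -> R}.
Hypothesis Om_segment : forall i, closed_segment (Om i) (lo i) (hi i).
Hypothesis G_continuous : forall i,
  {within Om i `*` [set: R], continuous (G i)}.

Lemma cvg_evaluation {T : Type} (F : set_system T) {FF : Filter F}
    (i : 'I_N) (u v : T -> R) (p q : R) :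
  (forall t, Om i (u t)) -> Om i p -> u @ F --> p -> v @ F --> q ->
  (fun t => G i (u t, v t)) @ F --> G i (p, q).
Proof.
move=> uOm pOm up vq.
have Gc := (subspace_continuousP _ _).1 (G_continuous i) (p, q).
apply: cvg_trans (Gc (conj pOm I)).
have uv : (fun t => (u t, v t)) @ F --> (p, q) by exact: (cvg_pair (G := nbhs p) (H := nbhs q) up vq).
move=> B /= HB; rewrite /nbhs/=.
have := uv _ HB; rewrite /nbhs/=; apply: filterS => t /= ; apply.
by split => //; exact: uOm.
Qed.

Lemma evaluation_bounded (M : R) : exists B, forall i z u,
  Om i z -> `|u| <= M -> `|G i (z, u)| <= B.
Proof.
have /choice[B HB] : forall i, exists B, forall z u,
    Om i z -> `|u| <= M -> `|G i (z, u)| <= B.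
  move=> i; have cOm : compact (Om i).
    rewrite (_ : Om i = `[lo i, hi i]%classic); first exact: segment_compact.
    apply/seteqP; split=> z /=; rewrite in_itv/=; first by move/Om_segment.
    by move=> h; apply/Om_segment.
  have cA : compact (Om i `*` `[- M, M]%classic).
    by apply: compact_setX => //; exact: segment_compact.
  have cG : {within Om i `*` `[- M, M]%classic, continuous (G i)}.
    apply: continuous_subspaceW (@G_continuous i).
    by move=> [z u] [? _].
  have /compact_bounded[B [_ HB]] := continuous_compact cG cA.
  exists (B + 1) => z u zOm uM; apply: (HB (B + 1)); first by rewrite ltrDl.
  by exists (z, u) => //; split => //=; rewrite in_itv/= -ler_norml.
exists (\sum_i `|B i|) => i z u zOm uM; apply: le_trans (HB i z u zOm uM) _.
apply: le_trans (ler_norm _) _; rewrite (bigD1 i)//= lerDl.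
exact: sumr_ge0.
Qed.

Lemma profiles_bounded : exists2 D, 0 <= D & forall i z, Om i z -> `|z| <= D.
Proof.
exists (\sum_i (`|lo i| + `|hi i|)).
  by apply: sumr_ge0 => i _; rewrite addr_ge0.
move=> i z /Om_segment /andP[lz zh].
apply: (@le_trans _ _ (`|lo i| + `|hi i|)).
  rewrite ler_norml; have := ler_norm (hi i); have := ler_norm (- lo i).
  rewrite normrN; have := normr_ge0 (hi i); have := normr_ge0 (lo i).
  by move=> *; apply/andP; split; lra.
by rewrite (bigD1 i)//= lerDl; apply: sumr_ge0 => j _; rewrite addr_ge0.
Qed.

Hypothesis N_gt0 : (0 < N)%N.

Lemma avg_bounded (x : 'I_N -> R) (D : R) : (forall i, `|x i| <= D) ->
  `|avg x| <= D.
Proof.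
move=> xD; have N0 : 0 < N%:R :> R by rewrite ltr0n.
rewrite /avg normrM ger0_norm ?invr_ge0 ?ler0n//.
rewrite ler_pdivrMl//; apply: le_trans (ler_norm_sum _ _ _) _.
apply: le_trans (ler_sum _ (fun i _ => xD i)) _.
by rewrite sumr_const card_ord mulr_natl.
Qed.

Lemma avgB (x z : 'I_N -> R) : avg x - avg z = avg (fun i => x i - z i).
Proof. by rewrite /avg sumrB mulrBr. Qed.

Lemma sum_sub_avg (v x : 'I_N -> R) : \sum_i v i = \sum_i x i ->
  \sum_i (v i - avg x) = 0.
Proof.
move=> vx; rewrite sumrB vx sumr_const card_ord -mulr_natl /avg mulrA divff ?mul1r ?subrr//.
by rewrite pnatr_eq0 -lt0n.
Qed.

End Evaluation.

Section EstimatesConsensus.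
Context {R : realType} {N : nat} {e : rel 'I_N} {L : 'M[R]_N}.
Hypothesis e_connected : connected_graph e.
Hypothesis L_weights : weight_matrix e L.
Hypothesis N_gt0 : (0 < N)%N.
Context {Om : 'I_N -> set R} {lo hi : 'I_N -> R} {G : 'I_N -> R * R -> R}.
Hypothesis Om_segment : forall i, closed_segment (Om i) (lo i) (hi i).
Hypothesis G_continuous : forall i,
  {within Om i `*` [set: R], continuous (G i)}.
Context {lambda gamma : nat -> R} {x y b m : nat -> 'I_N -> R}.
Hypothesis lambda_gt0 : forall k, 0 < lambda k.
Hypothesis gamma_gt0 : forall k, 0 < gamma k.
Hypothesis gamma_divergent : divergent_sums gamma.
Hypothesis gamma_cvg0 : gamma @ \oo --> (0 : R).
Hypothesis ratio_tails : vanishing_tails (fun k => lambda k ^+ 2 / gamma k).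
Hypothesis x_Om : forall k i, Om i (x k i).
Hypothesis x_step : forall k i,
  is_proj (Om i) (x k i - lambda k * G i (x k i, y k i)) (x k.+1 i).
Hypothesis y_init : forall i, y 0%N i = x 0%N i.
Hypothesis y_step : forall k i, y k.+1 i = y k i
  + gamma k * laplacian L (fun j => y k j + b k j + m k j) i
  + x k.+1 i - x k i.
Hypothesis b_vanishes : vanishes b.
Hypothesis m_series : forall i,
  cvgn (fun n => \sum_(0 <= k < n) gamma k * m k i).

(** The exchanges preserve the total, so that the mean of the estimates tracks
    the mean of the decisions exactly. *)
Lemma sum_estimates k : \sum_i y k i = \sum_i x k i.
Proof.
elim: k => [|k IH]; first by apply: eq_bigr => i _.
under eq_bigr do rewrite y_step.
by rewrite !big_split/= -mulr_sumr (sum_laplacian L_weights) sumrN IH; ring.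
Qed.

(** The gradients may be large where the estimates are, so that a bound on the
    estimates cannot come from the size of the gradient steps. It comes from
    y - x, which follows a consensus recursion driven by the decisions, and these
    stay in compact sets. *)
Lemma estimates_bounded : uniformly_bounded y.
Proof.
have [D D0 HD] := profiles_bounded Om_segment.
have bx : uniformly_bounded x by exists D => k i; exact: HD.
have : uniformly_bounded (fun k i => y k i - x k i).
  apply: (consensus_bounded e_connected L_weights (gamma := gamma)
    (b := fun k i => x k i + b k i) (m := m) (del := fun _ _ => 0)) => //.
  - by move=> k; rewrite sumrB sum_estimates subrr.
  - move=> k i; rewrite y_step (_ : (fun j => y k j - x k j + _ + _) =
      fun j => y k j + b k j + m k j); first ring.
    by apply/funext => j; ring.
  - by apply: uniformly_boundedD => //; exact: vanishes_bounded.
move=> /uniformly_boundedD/(_ bx) [M HM]; exists M => k i.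
by have := HM k i; rewrite subrK.
Qed.

Lemma gradients_bounded : exists2 B, 0 <= B &
  forall k i, `|G i (x k i, y k i)| <= B.
Proof.
have [M HM] := estimates_bounded.
have [B HB] := evaluation_bounded Om_segment G_continuous M.
exists B; last by move=> k i; exact: HB.
have := HB (Ordinal N_gt0) _ _ (x_Om 0%N _) (HM 0%N (Ordinal N_gt0)).
exact: le_trans.
Qed.

(** With bounded gradients the decisions move by O(lambda k), and the
    contributions lambda^2 / gamma of these moves to the disagreement are
    summable. *)
Lemma estimates_consensus : vanishes (fun k i => y k i - avg (x k)).
Proof.
have [B B0 HB] := gradients_bounded.
pose del k i := (x k.+1 i - x k i) - (avg (x k.+1) - avg (x k)).
have dx k i : `|x k.+1 i - x k i| <= lambda k * B.
  have := is_proj_dist_le (Om_segment i) (x_step k i) (x_Om k i).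
  move=> /le_trans; apply; rewrite addrAC subrr add0r normrN normrM gtr0_norm//.
  by rewrite ler_pM2l.
apply: (consensus_cvg e_connected L_weights (gamma := gamma) (b := b) (m := m)
  (del := del)) => //.
- by move=> k; apply: sum_sub_avg => //; exact: sum_estimates.
- move=> k i; rewrite y_step /del.
  rewrite (_ : laplacian L (fun j => y k j - avg (x k) + b k j + m k j) i =
    laplacian L (fun j => y k j + b k j + m k j) i); first ring.
  rewrite -[RHS](laplacian_shift (- avg (x k))); congr laplacian.
  by apply/funext => j; ring.
- pose K : R := \sum_(i < N) (2 * B) ^+ 2.
  have vK : vanishing_tails (fun k => K * (lambda k ^+ 2 / gamma k)).
    by apply: vanishing_tailsZ => //; apply: sumr_ge0 => i _; rewrite sqr_ge0.
  move=> eps /vK[k0 Hk0]; exists k0 => p n k0p; apply: le_trans (Hk0 p n k0p).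
  apply: ler_sum => k _; rewrite mulrA ler_pM2r ?invr_gt0//.
  rewrite /K mulr_suml; apply: ler_sum => i _.
  rewrite -exprMn -[leLHS]real_normK ?num_real// lerXn2r ?nnegrE//.
    by rewrite !mulr_ge0// ltW.
  rewrite /del; apply: le_trans (ler_normB _ _) _.
  rewrite avgB (_ : 2 * B * lambda k = lambda k * B + lambda k * B); last ring.
  by rewrite lerD//; apply: avg_bounded => // j.
Qed.

End EstimatesConsensus.

(** * Variational inequality and projected gradient steps *)

Section ProjectedStep.
Context {R : realType} {N : nat}.
Context {Om : 'I_N -> set R} {lo hi : 'I_N -> R}.
Hypothesis Om_segment : forall i, closed_segment (Om i) (lo i) (hi i).

Lemma projected_step (lam : R) {x g p z : 'I_N -> R} :
  (forall i, is_proj (Om i) (x i - lam * g i) (p i)) -> profiles Om z ->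
  sqnorm (fun i => p i - z i) <= sqnorm (fun i => x i - z i)
    - 2 * lam * (\sum_i g i * (x i - z i)) + lam ^+ 2 * sqnorm g.
Proof.
move=> xp zOm; rewrite /sqnorm !mulr_sumr -sumrB -big_split/=.
apply: ler_sum => i _.
have := is_proj_sqr_le (Om_segment i) (xp i) (zOm i).
by move=> /le_trans; apply; rewrite le_eqVlt; apply/orP; left; apply/eqP; ring.
Qed.

End ProjectedStep.

Definition aggregate_map {R : realType} {N : nat} (G : 'I_N -> R * R -> R)
    (x : 'I_N -> R) (i : 'I_N) : R := G i (x i, avg x).

Section VariationalInequality.
Context {R : realType} {N : nat}.
Hypothesis N_gt0 : (0 < N)%N.
Context {Om : 'I_N -> set R} {lo hi : 'I_N -> R} {G : 'I_N -> R * R -> R}.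
Hypothesis Om_segment : forall i, closed_segment (Om i) (lo i) (hi i).
Hypothesis G_continuous : forall i,
  {within Om i `*` [set: R], continuous (G i)}.
Context {x0 : 'I_N -> R}.
Hypothesis x0_Om : profiles Om x0.

Hypothesis G_monotone : forall x z, profiles Om x -> profiles Om z -> x <> z ->
  0 < \sum_i (aggregate_map G x i - aggregate_map G z i) * (x i - z i).

Lemma aggregate_map_bounded : exists2 B, 0 <= B &
  forall x i, profiles Om x -> `|aggregate_map G x i| <= B.
Proof.
have [D D0 HD] := profiles_bounded Om_segment.
have [B HB] := evaluation_bounded Om_segment G_continuous D.
have H x i : profiles Om x -> `|aggregate_map G x i| <= B.
  by move=> xOm; apply: HB => //; apply: avg_bounded => // j; exact: HD.
exists B => //; have := H x0 (Ordinal N_gt0) x0_Om; exact: le_trans.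
Qed.

Lemma monotone_le {x z} : profiles Om x -> profiles Om z ->
  \sum_i aggregate_map G z i * (x i - z i) <= \sum_i aggregate_map G x i * (x i - z i).
Proof.
move=> xOm zOm; rewrite -subr_ge0 -sumrB.
have [->|xz] := pselect (x = z).
  by rewrite big1// => i _; rewrite subrr.
by under eq_bigr do rewrite -mulrBl; exact/ltW/G_monotone.
Qed.

(** Existence without a fixed point theorem: sum the projected gradient
    inequalities with a small constant step against a fixed z; monotonicity
    replaces the map at the iterates by the map at z, after which the left side
    depends on the average of the iterates only. *)
Lemma minty_approx (eta : R) : 0 < eta -> exists2 x, profiles Om x &
  forall z, profiles Om z -> \sum_i aggregate_map G z i * (x i - z i) <= eta.
Proof.
move=> eta0; have [B B0 HB] := aggregate_map_bounded.
have [D D0 HD] := profiles_bounded Om_segment.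
pose q : R := \sum_(i < N) B ^+ 2.
pose C : R := \sum_(i < N) (2 * D) ^+ 2.
have q0 : 0 <= q by apply: sumr_ge0 => i _; rewrite sqr_ge0.
pose lam := eta / (q + 1).
have lam0 : 0 < lam by rewrite divr_gt0//; lra.
have lamq : lam * q <= eta.
  by rewrite /lam mulrAC ler_pdivrMr; [nra|lra].
pose step x i := Num.max (lo i) (Num.min (x i - lam * aggregate_map G x i) (hi i)).
pose it k := iter k step x0.
have lohi i : lo i <= hi i.
  by have /Om_segment/andP[h1 h2] := x0_Om i; exact: le_trans h2.
have stepP x i : is_proj (Om i) (x i - lam * aggregate_map G x i) (step x i).
  exact: clamp_is_proj.
have itOm k : profiles Om (it k).
  by case: k => [//|k] i; have [] := stepP (it k) i.
pose n := (Num.trunc (C / (lam * eta))).+1.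
have le0 : 0 < lam * eta by rewrite mulr_gt0.
have C0 : 0 <= C by apply: sumr_ge0 => i _; rewrite sqr_ge0.
have nC : C <= n%:R * (lam * eta).
  have /andP[_ /ltW] := truncn_itv (divr_ge0 C0 (ltW le0)).
  by rewrite ler_pdivrMr.
have n0 : 0 < n%:R :> R by rewrite ltr0n.
pose x i := n%:R^-1 * \sum_(k < n) it k i.
have xOm : profiles Om x.
  move=> i; apply/Om_segment; rewrite /x ler_pdivlMl// ler_pdivrMl//.
  have cst (c : R) : n%:R * c = \sum_(k < n) c.
    by rewrite sumr_const card_ord mulr_natl.
  rewrite !cst; apply/andP; split; apply: ler_sum => k _;
  by have /Om_segment/andP[] := itOm k i.
exists x => // z zOm.
have iterate m : 2 * lam * (\sum_(k < m) \sum_i aggregate_map G z i * (it k i - z i))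
    <= C - sqnorm (fun i => it m i - z i) + m%:R * (lam ^+ 2 * q).
  elim: m => [|m IH].
    rewrite big_ord0 mulr0 mul0r addr0 subr_ge0; apply: ler_sum => i _.
    rewrite -real_normK ?num_real// lerXn2r ?nnegrE ?mulr_ge0//.
    apply: le_trans (ler_normB _ _) _.
    by rewrite mulr_natl mulr2n; apply: lerD; exact: (HD i).
  rewrite big_ord_recr/= mulrDr -natr1 mulrDl mul1r.
  have := projected_step Om_segment lam (stepP (it m)) zOm.
  have := ler_wpM2l (ltW lam0) (monotone_le (itOm m) zOm).
  have : lam ^+ 2 * sqnorm (aggregate_map G (it m)) <= lam ^+ 2 * q.
    rewrite ler_wpM2l ?sqr_ge0//; apply: ler_sum => i _.
    by rewrite -real_normK ?num_real// lerXn2r ?nnegrE// HB.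
  lra.
have avgE : n%:R * (\sum_i aggregate_map G z i * (x i - z i)) =
    \sum_(k < n) \sum_i aggregate_map G z i * (it k i - z i).
  rewrite exchange_big/= mulr_sumr; apply: eq_bigr => i _.
  rewrite -mulr_sumr sumrB sumr_const card_ord -[_ *+ n]mulr_natl /x.
  by field; rewrite gt_eqF.
have main := iterate n; rewrite -avgE in main.
have V0 := sqnorm_ge0 (fun i => it n i - z i).
have nl : 0 < n%:R * lam by rewrite mulr_gt0.
rewrite -(ler_pM2l nl).
have h1 : n%:R * lam * (lam * q) <= n%:R * lam * eta by rewrite ler_pM2l.
rewrite expr2 in main; lra.
Qed.


Lemma profiles_compact :
  compact ([set f | forall i, Om i (f i)] : set (prod_topology (fun _ : 'I_N => R))).
Proof.
apply: (@tychonoff 'I_N (fun=> R) Om) => i.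
rewrite (_ : Om i = `[lo i, hi i]%classic); first exact: segment_compact.
apply/seteqP; split=> z /=; rewrite in_itv/=; first by move/Om_segment.
by move=> h; apply/Om_segment.
Qed.


Lemma cvg_coordinate (x : prod_topology (fun _ : 'I_N => R)) (i : 'I_N) :
  (fun z : prod_topology (fun _ : 'I_N => R) => z i) @ x --> x i.
Proof. exact: (@proj_continuous 'I_N (fun=> R) i x). Qed.

Lemma cvg_avg {T : Type} (F : set_system T) {FF : Filter F}
    (v : T -> 'I_N -> R) (l : 'I_N -> R) :
  (forall i, (fun t => v t i) @ F --> l i) -> (fun t => avg (v t)) @ F --> avg l.
Proof. by move=> vl; apply: cvgMr; exact: cvg_sumr. Qed.

(** A cluster point of the approximate solutions is an exact one. *)
Lemma minty : exists2 x, profiles Om x &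
  forall z, profiles Om z -> \sum_i aggregate_map G z i * (x i - z i) <= 0.
Proof.
have /choice[u Hu] : forall n : nat, exists x, profiles Om x /\
    forall z, profiles Om z ->
      \sum_i aggregate_map G z i * (x i - z i) <= n.+1%:R^-1.
  move=> n; have [|x xOm Hx] := @minty_approx n.+1%:R^-1; last by exists x.
  by rewrite invr_gt0 ltr0n.
have uOm : (u @ \oo) [set f | forall i, Om i (f i)].
  by exists 0%N => // n _; exact: (Hu n).1.
have [x [xOm xclu]] := profiles_compact (u @ \oo) _ uOm. exists x => // z zOm.
pose l (f : 'I_N -> R) := \sum_i aggregate_map G z i * (f i - z i).
rewrite leNgt; apply/negP => lx; rewrite -/(l x) in lx.
pose PT := prod_topology (fun _ : 'I_N => R).
have H i : (fun f : PT => aggregate_map G z i * (f i - z i)) @ nbhs (x : PT) -->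
    aggregate_map G z i * (x i - z i).
  have h1 := @cvg_coordinate x i.
  have h2 : (fun f : PT => f i - z i) @ nbhs (x : PT) --> x i - z i.
    exact: cvgB h1 (cvg_cst _).
  exact: cvgMr h2.
have lc := @cvg_sumr R PT 'I_N (nbhs (x : PT)) (nbhs_filter (x : PT))
  (index_enum 'I_N) _ _ H.
have l20 : 0 < l x / 2 by rewrite divr_gt0.
have near_x := (cvgrPdist_lt _ _).1 lc _ l20.
pose n0 := Num.trunc (l x / 2)^-1.
have n0P : n0.+1%:R^-1 < l x / 2.
  have li0 : 0 <= (l x / 2)^-1 by rewrite invr_ge0 ltW.
  have /andP[_ h] := truncn_itv li0.
  by rewrite invf_plt ?posrE ?ltr0n.
have tail : (u @ \oo) [set f | l f <= n0.+1%:R^-1].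
  exists n0 => // n /= n0n; apply: le_trans ((Hu n).2 z zOm) _.
  by rewrite lef_pV2 ?posrE ?ltr0n// ler_nat.
have nx : nbhs x [set f | `|l x - l f| < l x / 2] by exact: near_x.
have [f [/= lf]] := xclu _ _ tail nx.
rewrite ltr_norml => /andP[_ h].
have h2 : l x / 2 < l f by move: h; move: (l f) (l x) => p q; lra.
by have := lt_trans n0P h2; rewrite ltNge lf.
Qed.

(** Minty's lemma: test the inequality at points z n of the segment from x to w
    that tend to x, divide by their distance, and use continuity. *)
Lemma variational_solution : exists2 x, profiles Om x &
  forall z, profiles Om z -> 0 <= \sum_i aggregate_map G x i * (z i - x i).
Proof.
have [x xOm Hx] := minty; exists x => // w wOm.
pose t (n : nat) : R := n.+1%:R^-1.
have t0 n : 0 < t n by rewrite invr_gt0 ltr0n.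
have t1 n : t n <= 1 by rewrite invf_le1 ?ltr0n// ler1n.
pose z n i := x i + t n * (w i - x i).
have zOm n : profiles Om (z n).
  move=> i; apply/Om_segment; have /Om_segment/andP[x1 x2] := xOm i.
  have /Om_segment/andP[w1 w2] := wOm i; have := t0 n; have := t1 n.
  by rewrite /z => *; apply/andP; split; nra.
have zx i : (fun n => z n i) @ \oo --> x i.
  rewrite -[X in _ --> X]addr0 -[X in _ --> _ + X](mul0r (w i - x i)).
  apply: cvgD; first exact: cvg_cst.
  by apply: cvgMl; exact: cvg_harmonic.
have cv : (fun n => \sum_i aggregate_map G (z n) i * (w i - x i)) @ \oo -->
    \sum_i aggregate_map G x i * (w i - x i).
  apply: cvg_sumr => i; apply: cvgMl.
  apply: (cvg_evaluation G_continuous) => //.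
    by move=> n; exact: zOm.
  exact: cvg_avg.
rewrite -(cvg_lim _ cv)//; apply: limr_ge; first by apply/cvg_ex; eexists; exact: cv.
apply: nearW => n; have := Hx (z n) (zOm n).
have -> : \sum_i aggregate_map G (z n) i * (x i - z n i) =
    - (t n * \sum_i aggregate_map G (z n) i * (w i - x i)).
  by rewrite mulr_sumr -sumrN; apply: eq_bigr => i _; rewrite /z; ring.
by rewrite oppr_le0 pmulr_rge0.
Qed.

Context {xs : 'I_N -> R}.
Hypothesis xs_Om : profiles Om xs.
Hypothesis xs_vi : forall z, profiles Om z ->
  0 <= \sum_i aggregate_map G xs i * (z i - xs i).

Lemma evaluation_near (x : 'I_N -> R) (eps : R) (i : 'I_N) :
  profiles Om x -> 0 < eps -> exists2 r, 0 < r &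
  forall u v, Om i u -> `|x i - u| < r -> `|avg x - v| < r ->
    aggregate_map G x i * (x i - xs i) - eps < G i (u, v) * (u - xs i).
Proof.
move=> xOm eps0; pose A := Om i `*` [set: R].
have Gc := (subspace_continuousP _ _).1 (G_continuous i) (x i, avg x)
  (conj (xOm i) I).
have fc : (fun p : R * R => p.1 - xs i) @ within A (nbhs (x i, avg x)) -->
    x i - xs i.
  apply: cvgB; last exact: cvg_cst.
  by apply: cvg_within_filter; exact: cvg_fst.
have FW : Filter (within A (nbhs (x i, avg x))) by exact: within_filter.
have near_p : nbhs (x i, avg x) [set p | A p ->
    `|G i (x i, avg x) * (x i - xs i) - G i p * (p.1 - xs i)| < eps].
  exact: ((cvgrPdist_lt _ _).1 (cvgM Gc fc) _ eps0).
have /nbhs_ballP[r /= r0 Hr] := near_p.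
exists r => // u v uOm xu xv.
have := Hr (u, v); rewrite /ball/= => /(_ (conj xu xv) (conj uOm I)).
by rewrite /= ltr_norml /aggregate_map => /andP[_]; lra.
Qed.

(** At each profile other than xs the sum is positive when the estimates are
    exact, by strict monotonicity; by continuity it stays positive nearby, also
    for inexact estimates, and compactness makes the bound uniform. *)
Lemma uniform_separation (del : R) : 0 < del -> exists2 eta, 0 < eta &
  forall x y, profiles Om x -> del <= sqnorm (fun i => x i - xs i) ->
    (forall i, `|y i - avg x| <= eta) ->
    eta <= \sum_i G i (x i, y i) * (x i - xs i).
Proof.
move=> del0; pose PT := prod_topology (fun _ : 'I_N => R).
pose Q (eta : R) (x : PT) :=
  del <= sqnorm (fun i => x i - xs i) -> forall y : 'I_N -> R,
    (forall i, `|y i - avg x| <= eta) ->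
    eta <= \sum_i G i (x i, y i) * (x i - xs i).
have /compact_near_coveringP/near_covering_withinP cov := profiles_compact.
have local (x : PT) : profiles Om x ->
    \forall x' \near x & eta \near (0 : R)^'+, profiles Om x' -> Q eta x'.
  move=> xOm.
  have xc (i : 'I_N) (r : R) : 0 < r ->
      \forall x' \near (x : PT), `|x i - x' i| < r.
    by move=> r0; apply: ((cvgrPdist_lt _ _).1 (cvg_coordinate x i) r r0).
  have [lt|ge] := ltP (sqnorm (fun i => x i - xs i)) del.
    have c1 (i : 'I_N) : (fun f : PT => (f i - xs i) ^+ 2) @ nbhs (x : PT) -->
        (x i - xs i) ^+ 2.
      have h : (fun f : PT => f i - xs i) @ nbhs (x : PT) --> x i - xs i.
        exact: cvgB (cvg_coordinate x i) (cvg_cst _).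
      exact: (cvgM h h).
    have c2 := @cvg_sumr R PT 'I_N (nbhs (x : PT)) (nbhs_filter (x : PT))
      (index_enum 'I_N) _ _ c1.
    have gap : 0 < del - sqnorm (fun i => x i - xs i) by rewrite subr_gt0.
    have nx : \forall x' \near (x : PT),
        `|sqnorm (fun i => x i - xs i) - sqnorm (fun i => x' i - xs i)| <
        del - sqnorm (fun i => x i - xs i).
      exact: ((cvgrPdist_lt _ _).1 c2 _ gap).
    near=> x' eta => _; rewrite /Q leNgt => /negP[].
    have : `|sqnorm (fun i => x i - xs i) - sqnorm (fun i => x' i - xs i)| <
      del - sqnorm (fun i => x i - xs i) by near: x'.
    by rewrite ltr_norml => /andP[h _]; lra.
  pose h0 := \sum_i aggregate_map G x i * (x i - xs i).
  have h00 : 0 < h0.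
    have xxs : x <> xs.
      move=> E; move: ge; rewrite E /sqnorm big1 ?leNgt ?del0// => i _.
      by rewrite subrr expr0n.
    have := xs_vi x xOm; have := G_monotone x xs xOm xs_Om xxs.
    rewrite /h0; under eq_bigr do rewrite mulrBl.
    by rewrite sumrB; lra.
  have NR0 : 0 < N%:R :> R by rewrite ltr0n.
  pose eps := h0 / (2 * N%:R).
  have eps0 : 0 < eps by rewrite divr_gt0// mulr_gt0.
  have /choice[r Hr] : forall i : 'I_N, exists r, 0 < r /\
      forall u v, Om i u -> `|x i - u| < r -> `|avg x - v| < r ->
      aggregate_map G x i * (x i - xs i) - eps < G i (u, v) * (u - xs i).
    by move=> i; have [r r0 H] := evaluation_near x eps i xOm eps0; exists r.
  have r20 i : 0 < r i / 2 by rewrite divr_gt0//; case: (Hr i).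
  have near1 : \forall x' \near (x : PT), forall i, `|x i - x' i| < r i.
    apply: (@filter_forall PT 'I_N (fun i x' => `|x i - x' i| < r i)
      (nbhs (x : PT)) (nbhs_filter (x : PT))) => i.
    by apply: xc; case: (Hr i).
  have ca := @cvg_avg PT (nbhs (x : PT)) (nbhs_filter (x : PT)) id x
    (cvg_coordinate x).
  have near2 : \forall x' \near (x : PT), forall i, `|avg x - avg x'| < r i / 2.
    apply: (@filter_forall PT 'I_N (fun i x' => `|avg x - avg x'| < r i / 2)
      (nbhs (x : PT)) (nbhs_filter (x : PT))) => i.
    exact: ((cvgrPdist_lt _ _).1 ca (r i / 2) (r20 i)).
  have near3 : \forall eta \near (0 : R)^'+, forall i, eta < r i / 2.
    by apply: filter_forall => i; exact: nbhs_right_lt.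
  have h20 : 0 < h0 / 2 by rewrite divr_gt0.
  have near4 : \forall eta \near (0 : R)^'+, eta <= h0 / 2.
    exact: nbhs_right_le.
  near=> x' eta => x'Om _ y yx.
  have n1 : forall i, `|x i - x' i| < r i by near: x'.
  have n2 : forall i, `|avg x - avg x'| < r i / 2 by near: x'.
  have n3 : forall i, eta < r i / 2 by near: eta.
  have n4 : eta <= h0 / 2 by near: eta.
  apply: le_trans n4 _.
  have -> : h0 / 2 = \sum_i (aggregate_map G x i * (x i - xs i) - eps).
    rewrite sumrB -/h0 sumr_const card_ord -[_ *+ N]mulr_natl /eps.
    by field; rewrite gt_eqF.
  apply: ler_sum => i _; have [_ H] := Hr i.
  apply/ltW/H; [exact: x'Om|exact: n1|].
  rewrite -[avg x](subrK (avg x')) -addrA.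
  apply: le_lt_trans (ler_normD _ _) _.
  rewrite [ltRHS](splitr (r i)); apply: ltrD; first exact: n2.
  by rewrite distrC; exact: le_lt_trans (yx i) (n3 i).
have nearQ := cov R (0 : R)^'+ Q _ local.
have : \forall eta \near (0 : R)^'+, 0 < eta /\
    [set f | forall i, Om i (f i)] `<=` Q eta.
  by apply: filterI; [exact: nbhs_right_gt|exact: nearQ].
move=> /filter_ex[eta [eta0 HQ]]; exists eta => // x y xOm dx.
exact: (HQ x xOm dx y).
Unshelve. all: by end_near. Qed.

(** A step of length lam decreases the squared distance by at least lam eta
    when the state is away from the solution and changes it little otherwise;
    this is where the steps must vanish but have an infinite sum. *)
Lemma gradient_play_cvg {lambda : nat -> R} {x y : nat -> 'I_N -> R} {B : R} :
  (forall k, 0 < lambda k) -> lambda @ \oo --> (0 : R) -> divergent_sums lambda ->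
  (forall k, profiles Om (x k)) ->
  (forall k i, is_proj (Om i) (x k i - lambda k * G i (x k i, y k i)) (x k.+1 i)) ->
  (forall k i, `|G i (x k i, y k i)| <= B) ->
  vanishes (fun k i => y k i - avg (x k)) ->
  vanishes (fun k i => x k i - xs i).
Proof.
move=> lam0 lamc lamd xOm xstep GB yx.
pose V k := sqnorm (fun i => x k i - xs i).
pose C : R := N%:R * B ^+ 2 + 1.
have C0 : 0 < C by rewrite ltr_wpDl// mulr_ge0// sqr_ge0.
have gC k : sqnorm (fun i => G i (x k i, y k i)) <= C.
  apply: (@le_trans _ _ (\sum_(i < N) B ^+ 2)); last first.
    by rewrite sumr_const card_ord /C mulr_natl lerDl.
  apply: ler_sum => i _; rewrite -real_normK ?num_real//.
  by rewrite lerXn2r ?nnegrE//; exact: le_trans (GB k i).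
have [D D0 HD] := profiles_bounded Om_segment.
pose H k := \sum_i G i (x k i, y k i) * (x k i - xs i).
have VS k : V k.+1 <= V k - 2 * lambda k * H k + lambda k ^+ 2 * C.
  apply: le_trans (projected_step Om_segment _ (xstep k) xs_Om) _.
  by rewrite lerD2l ler_wpM2l ?sqr_ge0.
have B0 : 0 <= B by apply: le_trans (GB 0%N (Ordinal N_gt0)).
pose K : R := N%:R * (B * (2 * D)).
have K0 : 0 <= K by rewrite !mulr_ge0.
have HK k : - K <= H k.
  rewrite /K mulr_natl -[X in _ *+ X](card_ord N) -sumr_const -sumrN.
  apply: ler_sum => i _; rewrite lerNl; apply: le_trans (ler_norm _) _.
  rewrite normrN normrM; apply: ler_pM => //.
  apply: le_trans (ler_normB _ _) _; rewrite mulr_natl mulr2n.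
  by apply: lerD; [exact: (HD i _ (xOm k i))|exact: (HD i _ (xs_Om i))].
apply: sqnorm_vanishes; rewrite -/V.
apply/cvgrPdist_le => eps eps0.
pose del := eps / 2; have del0 : 0 < del by rewrite divr_gt0.
have [eta eta0 sep] := uniform_separation del del0.
have e1 : 0 < eta / C by rewrite divr_gt0.
have e2 : 0 < del / (2 * K + C) by rewrite divr_gt0//; lra.
have near_y : \forall k \near \oo, forall i, `|y k i - avg (x k)| <= eta.
  apply: filter_forall => i; have [q _ Hq] := (cvgrPdist_le _ _).1 (yx i) _ eta0.
  by exists q => // k /Hq/=; rewrite sub0r normrN.
have near_l : \forall k \near \oo, [/\ lambda k <= eta / C,
    lambda k <= del / (2 * K + C) & lambda k <= 1].
  have nl (r : R) : 0 < r -> \forall k \near \oo, lambda k <= r.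
    move=> r0; have [q _ Hq] := (cvgrPdist_le _ _).1 lamc _ r0.
    by exists q => // k /Hq/=; rewrite sub0r normrN; exact/le_trans/ler_norm.
  near=> k; split; near: k; [exact: nl|exact: nl|exact: nl].
have [k0 _ Hk0] : \forall k \near \oo,
    (forall i, `|y k i - avg (x k)| <= eta) /\ [/\ lambda k <= eta / C,
    lambda k <= del / (2 * K + C) & lambda k <= 1] by exact: filterI.
have de : del <= eps by rewrite /del; lra.
have [k1 Hk1] : exists k1, forall k, (k1 <= k)%N -> V k <= eps.
  apply: (eventually_le (K := k0) lamd (fun k => ltW (lam0 k)) eta0 de).
  - move=> k /Hk0[ky [l1 l2 l3]] dV; have := VS k.
    have hH : eta <= H k by exact: sep.
    have l0 := lam0 k.
    have : lambda k * (lambda k * C) <= lambda k * eta.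
      by rewrite ler_pM2l// -ler_pdivlMr.
    have : lambda k * eta <= lambda k * H k by rewrite ler_pM2l.
    rewrite expr2; lra.
  - move=> k /Hk0[ky [l1 l2 l3]] Vd; have := VS k; have l0 := lam0 k.
    have : lambda k * (- K) <= lambda k * H k by rewrite ler_pM2l.
    have : lambda k * (lambda k * C) <= lambda k * C.
      by rewrite ler_pM2l// ler_piMl// ltW.
    have : lambda k * (2 * K + C) <= del by rewrite -ler_pdivlMr//; lra.
    have : del + del = eps by rewrite /del -splitr.
    move: Vd; rewrite expr2; lra.
exists k1 => // k /= /Hk1; rewrite sub0r normrN ger0_norm//; exact: sqnorm_ge0.
Unshelve. all: by end_near. Qed.

End VariationalInequality.

(** * Nash equilibria *)

Section NashEquilibria.
Context {R : realType} {N : nat}.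
Hypothesis N_gt0 : (0 < N)%N.
Context {Om : 'I_N -> set R} {lo hi : 'I_N -> R} {f G : 'I_N -> R * R -> R}.
Hypothesis Om_segment : forall i, closed_segment (Om i) (lo i) (hi i).
Hypothesis regular : regular_game Om f.
Hypothesis monotone : strictly_monotone_game Om f.
Hypothesis extG : extends_gradient Om f G.

Lemma avg_update (x : 'I_N -> R) i t :
  avg [eta x with i |-> t] = avg x + N%:R^-1 * (t - x i).
Proof.
rewrite /avg -mulrDr; congr (_ * _).
have E : \sum_(j < N | j != i) (if j == i then t else x j) = \sum_(j < N | j != i) x j.
  by apply: eq_bigr => j /negbTE ->.
rewrite (bigD1 i)//= eqxx E [in RHS](bigD1 i)//=; ring.
Qed.

Lemma update_id (x : 'I_N -> R) i : [eta x with i |-> x i] = x :> ('I_N -> R).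
Proof. by apply/funext => j /=; case: eqP => [->|]. Qed.

Lemma profiles_update {x} i {t} : profiles Om x -> Om i t ->
  profiles Om [eta x with i |-> t].
Proof. by move=> xOm tOm j /=; case: eqP => [->|_]; [|exact: xOm]. Qed.

Lemma game_mapE x i : profiles Om x -> game_map f x i = aggregate_map G x i.
Proof.
move=> xOm; have [E _] := extG i; rewrite /aggregate_map E//.
by exists x.
Qed.

Lemma cost_is_derive {x i} {t : R} : profiles Om x -> Om i t ->
  is_derive t 1 (fun s : R => cost f i [eta x with i |-> s])
    (game_map f [eta x with i |-> t] i).
Proof.
move=> xOm tOm; have x'Om := profiles_update i xOm tOm.
have [_ _ _ [U [_ sub cd]]] := regular i.
pose p : R^o * R^o := (t, avg x + N%:R^-1 * (t - x i)).
have Up : U p.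
  by apply: sub; split => //=; exists [eta x with i |-> t]; rewrite // avg_update.
have [df _] := cd p Up.
have dv := diff_derivable (v := ((1 : R^o), (N%:R^-1 : R^o))) df.
have E : (fun h : R => h^-1 *: (((fun s : R => cost f i [eta x with i |-> s]) \o shift t)
      (h *: (1 : R)) - cost f i [eta x with i |-> t])) =
   (fun h : R => h^-1 *: (((f i : R^o * R^o -> R^o) \o shift p)
      (h *: ((1 : R^o), (N%:R^-1 : R^o))) - f i p)).
  apply/funext => h; rewrite /cost /= !avg_update /= eqxx.
  congr (_ *: (f i (_, _) - _)).
  (* the pair lives in the regular module of R: restate in the field R *)
  change (avg x + N%:R^-1 * (h * 1 + t - x i) =
    h * N%:R^-1 + (avg x + N%:R^-1 * (t - x i)) :> R).
  ring.
have pE : game_map f [eta x with i |-> t] i =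
    'D_((1 : R^o), (N%:R^-1 : R^o)) (f i : R^o * R^o -> R^o) p.
  by rewrite /game_map /grad avg_update /= eqxx.
apply: DeriveDef.
  by rewrite /derivable E.
by rewrite pE /derive E.
Qed.

Lemma cost_increment {x i p q} : profiles Om x -> Om i p -> Om i q -> p < q ->
  exists2 c, p < c < q & cost f i [eta x with i |-> q] - cost f i [eta x with i |-> p] =
    game_map f [eta x with i |-> c] i * (q - p).
Proof.
move=> xOm pOm qOm pq.
have inOm c : p <= c <= q -> Om i c.
  move=> /andP[pc cq]; have /Om_segment/andP[h1 _] := pOm.
  have /Om_segment/andP[_ h2] := qOm.
  by apply/Om_segment; rewrite (le_trans h1 pc) (le_trans cq h2).
have [||c] := @MVT R (fun s : R => cost f i [eta x with i |-> s])
  (fun s => game_map f [eta x with i |-> s] i) p q pq.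
- move=> c; rewrite in_itv/= => /andP[pc cq]; apply: cost_is_derive => //.
  by apply: inOm; rewrite !ltW.
- apply: continuous_in_subspaceT => c; rewrite inE/= in_itv/= => /inOm cOm.
  have [dc _] := cost_is_derive xOm cOm.
  by apply: differentiable_continuous; apply/derivable1_diffP.
- by rewrite in_itv/= => pcq E; exists c.
Qed.

(** The mean value theorem along the segment from x i to z, for the cost that
    takes the change of the average into account. *)
Lemma deviation_increment {x i z} : profiles Om x -> Om i z -> z <> x i ->
  exists s, [/\ 0 < s, s < 1 &
    cost f i [eta x with i |-> z] - cost f i x =
    game_map f [eta x with i |-> x i + s * (z - x i)] i * (z - x i)].
Proof.
move=> xOm zOm /eqP zx; have {2}<- := update_id x i.
have zx0 : z - x i != 0 by rewrite subr_eq0.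
have sE c : x i + (c - x i) / (z - x i) * (z - x i) = c by rewrite divfK// addrC subrK.
have [lt|gt] := ltP (x i) z.
  have [c /andP[c1 c2] ->] := cost_increment xOm (xOm i) zOm lt.
  exists ((c - x i) / (z - x i)); rewrite sE; split => //.
    by rewrite divr_gt0 ?subr_gt0.
  by rewrite ltr_pdivrMr ?subr_gt0// mul1r ltrD2r.
have {}gt : z < x i by rewrite lt_neqAle zx.
have [c /andP[c1 c2] E] := cost_increment xOm zOm (xOm i) gt.
exists ((c - x i) / (z - x i)); rewrite sE; split => //.
- by rewrite -mulrNN -invrN !opprB divr_gt0 ?subr_gt0.
- rewrite -mulrNN -invrN !opprB ltr_pdivrMr ?subr_gt0// mul1r; lra.
- by rewrite -[LHS]opprB E -mulrN opprB.
Qed.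

(** Strict monotonicity along one coordinate makes each cost convex in the own
    decision of the player, the average included, so that the first order
    conditions are sufficient. *)
Lemma variational_nash {x} : profiles Om x ->
  (forall z, profiles Om z -> 0 <= \sum_i aggregate_map G x i * (z i - x i)) ->
  nash_equilibrium Om f x.
Proof.
move=> xOm vi; split => // i z zOm.
have [->|zx] := eqVneq z (x i); first by rewrite update_id.
rewrite -subr_ge0.
have single (v : 'I_N -> R) (c : R) :
    \sum_j v j * ([eta x with i |-> c] j - x j) = v i * (c - x i).
  rewrite (bigD1 i)//= eqxx big1 ?addr0// => j /negbTE ->.
  by rewrite subrr mulr0.
have [s [s0 s1 ->]] := deviation_increment xOm zOm (elimN eqP zx).
set c := x i + s * (z - x i).
have cOm : Om i c.
  have /Om_segment/andP[x1 x2] := xOm i; have /Om_segment/andP[z1 z2] := zOm.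
  by apply/Om_segment; apply/andP; rewrite /c; split; nra.
have x'Om := profiles_update i xOm cOm.
have x'x : [eta x with i |-> c] <> x :> ('I_N -> R).
  move=> /(congr1 (fun g => g i)); rewrite /= eqxx /c => /eqP.
  by rewrite addrC -subr_eq0 addrK mulf_eq0 gt_eqF//= subr_eq0 (negbTE zx).
have := monotone _ _ x'Om xOm x'x; rewrite (single (fun j => _ - _)).
have := vi _ (profiles_update i xOm zOm); rewrite single.
rewrite -game_mapE// {2}/c => h1 h2.
set a := game_map f _ i in h2 *; set b := game_map f x i in h1 h2.
have : 0 < (a - b) * (z - x i).
  by rewrite -(pmulr_rgt0 _ s0); move: h2; congr (_ < _); rewrite /c; ring.
by rewrite mulrBl; lra.
Qed.

(** Deviations towards z that tend to x i cannot decrease the cost; by the mean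
    value theorem the derivative has the sign of z - x i at points that tend to
    x i, hence at x i. *)
Lemma nash_variational {x} : nash_equilibrium Om f x -> forall i z, Om i z ->
  0 <= aggregate_map G x i * (z - x i).
Proof.
move=> [xOm ne] i z zOm.
have [->|zx] := eqVneq z (x i); first by rewrite subrr mulr0.
pose t (n : nat) : R := n.+1%:R^-1.
have t0 n : 0 < t n by rewrite invr_gt0 ltr0n.
have t1 n : t n <= 1 by rewrite invf_le1 ?ltr0n// ler1n.
have between s : 0 <= s <= 1 -> Om i (x i + s * (z - x i)).
  move=> /andP[s0 s1]; have /Om_segment/andP[x1 x2] := xOm i.
  have /Om_segment/andP[z1 z2] := zOm.
  by apply/Om_segment; apply/andP; split; nra.
have /choice[s Hs] : forall n, exists s, [/\ 0 < s, s < t n &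
    0 <= game_map f [eta x with i |-> x i + s * (z - x i)] i * (z - x i)].
  move=> n; pose zn := x i + t n * (z - x i).
  have znOm : Om i zn by apply: between; rewrite ltW/=.
  have znx : zn - x i = t n * (z - x i) by rewrite /zn addrAC subrr add0r.
  have nx : zn <> x i.
    by apply/eqP; rewrite -subr_eq0 znx mulf_neq0 ?subr_eq0// gt_eqF.
  have [s [s0 s1 E]] := deviation_increment xOm znOm nx.
  exists (s * t n); split; [exact: mulr_gt0|by rewrite gtr_pMl|].
  have : 0 <= cost f i [eta x with i |-> zn] - cost f i x.
    by rewrite subr_ge0; exact: ne.
  rewrite E znx (_ : s * (t n * _) = s * t n * (z - x i)); last by rewrite mulrA.
  by rewrite mulrCA pmulr_rge0.
pose c n := x i + s n * (z - x i).
have s_cvg : s @ \oo --> (0 : R).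
  apply: (@squeeze_cvgr _ _ _ _ (fun=> 0) t s).
  - by near=> n; have [/ltW-> /ltW-> _] := Hs n.
  - exact: cvg_cst.
  - exact: cvg_harmonic.
have c_cvg : c @ \oo --> x i.
  rewrite -[X in _ --> X]addr0 -[X in _ --> _ + X](mul0r (z - x i)).
  by apply: cvgD; [exact: cvg_cst|exact: cvgMl].
have cOm n : Om i (c n).
  have [h0 h1 _] := Hs n; apply: between; rewrite ltW//=.
  exact: le_trans (ltW h1) (t1 n).
have cv : (fun n => G i (c n, avg x + N%:R^-1 * (c n - x i)) * (z - x i)) @ \oo -->
    aggregate_map G x i * (z - x i).
  apply: cvgMl; apply: (cvg_evaluation (fun i => (extG i).2)) => //.
  rewrite -[X in _ --> X]addr0 -[X in _ --> _ + X](mulr0 N%:R^-1).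
  apply: cvgD; first exact: cvg_cst.
  apply: cvgMr; rewrite -[X in _ --> X](subrr (x i)).
  by apply: cvgB => //; exact: cvg_cst.
rewrite -(cvg_lim _ cv)//; apply: limr_ge; first by apply/cvg_ex; eexists; exact: cv.
apply: nearW => n; have [_ _] := Hs n.
rewrite game_mapE; last by apply: profiles_update => //; exact: cOm.
by rewrite /aggregate_map avg_update /= eqxx.
Unshelve. all: by end_near. Qed.

Lemma nash_unique {x x'} : nash_equilibrium Om f x -> nash_equilibrium Om f x' ->
  x' = x.
Proof.
move=> nx nx'; apply: contrapT => xx'.
have := monotone x' x nx'.1 nx.1 xx'.
suff : \sum_i (game_map f x' i - game_map f x i) * (x' i - x i) <= 0.
  by rewrite leNgt => /negP.
apply: sumr_le0 => i _; rewrite !game_mapE; [|exact: nx.1|exact: nx'.1].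
have := nash_variational nx i (x' i) (nx'.1 i).
have := nash_variational nx' i (x i) (nx.1 i).
lra.
Qed.

Lemma aggregate_map_monotone {x z} : profiles Om x -> profiles Om z -> x <> z ->
  0 < \sum_i (aggregate_map G x i - aggregate_map G z i) * (x i - z i).
Proof.
move=> xOm zOm xz; have := monotone x z xOm zOm xz.
by under eq_bigr do rewrite !game_mapE//.
Qed.

End NashEquilibria.

(** * Convergence of the algorithm *)

Theorem theorem1 (R : realType) (N : nat) (N_gt0 : (0 < N)%N)
  (Om : 'I_N -> set R) (f : 'I_N -> R * R -> R)
  (regular : regular_game Om f)
  (lipschitz : lipschitz_gradients Om f)
  (monotone : strictly_monotone_game Om f)
  (G : 'I_N -> R * R -> R) (extG : extends_gradient Om f G)
  (e : rel 'I_N) (e_connected : connected_graph e)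
  (L : 'M[R]_N) (L_weights : weight_matrix e L)
  (disp : measure_display) (S : measurableType disp) (P : probability S R)
  (sigma c a d : R) (sigma_gt1 : 1 < sigma) (c_gt0 : 0 < c)
  (a_gt0 : 0 < a) (a_lt1 : a < 1) (d_gt0 : 0 < d)
  (lambda gamma : nat -> R)
  (lambda_gt0 : forall k, 0 < lambda k) (gamma_gt0 : forall k, 0 < gamma k)
  (x0 : 'I_N -> R) (x0_Om : profiles Om x0)
  (xi : 'I_N -> nat -> {RV P >-> R}) (x y : 'I_N -> nat -> S -> R)
  (yt : 'I_N -> nat -> {RV P >-> R})
  (trig : 'I_N -> nat -> S -> bool) (tau : 'I_N -> nat -> S -> nat)
  (run : algorithm_run Om G L sigma c d a_lt1 lambda gamma x0
           xi x y yt trig tau)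
  (rates : exists T : nat,
    [/\ (\sum_(T <= k <oo) (gamma k)%:E = +oo)%E,
        (\sum_(T <= k <oo) (lambda k)%:E = +oo)%E,
        (\sum_(T <= k <oo) ((gamma k) ^+ 2)%:E < +oo)%E &
        (\sum_(T <= k <oo) ((lambda k) ^+ 2 / gamma k)%:E < +oo)%E]) :
  exists xs : 'I_N -> R,
    [/\ nash_equilibrium Om f xs,
        forall x', nash_equilibrium Om f x' -> x' = xs &
        {ae P, forall w, forall i, `|x i k w - xs i| @[k --> \oo] --> (0 : R)}].
Proof.
have [T [gamma_oo lambda_oo gamma2_fin ratio_fin]] := rates.
have gamma_div := divergent_sums_of_series (fun k => ltW (gamma_gt0 k)) gamma_oo.
have lambda_div := divergent_sums_of_series (fun k => ltW (lambda_gt0 k)) lambda_oo.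
have gamma2_tails := vanishing_tails_of_series (fun k => sqr_ge0 (gamma k)) gamma2_fin.
have ratio_ge0 k : 0 <= lambda k ^+ 2 / gamma k.
  by rewrite divr_ge0 ?sqr_ge0// ltW.
have ratio_tails := vanishing_tails_of_series ratio_ge0 ratio_fin.
have gamma_cvg0 : gamma @ \oo --> (0 : R).
  apply: sqr_cvg0; apply: vanishing_tails_cvg0 => // k; exact: sqr_ge0.
have lambda_cvg0 : lambda @ \oo --> (0 : R).
  apply: sqr_cvg0; rewrite (_ : (fun k => _) =
    (fun k => lambda k ^+ 2 / gamma k * gamma k)); last first.
    by apply/funext => k; rewrite divfK// gt_eqF.
  rewrite -[X in _ --> X](mulr0 0); apply: cvgM => //.
  exact: vanishing_tails_cvg0.
have /choice[ab Hab] : forall i, exists ab : R * R, closed_segment (Om i) ab.1 ab.2.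
  move=> i; have [cOm vOm _ _] := regular i.
  have [a' [b' Hab]] := convex_compact_segment cOm vOm (ex_intro _ _ (x0_Om i)).
  by exists (a', b').
have G_cont i := (extG i).2.
have G_mono := fun x z => aggregate_map_monotone (x := x) (z := z) monotone extG.
have [xs xs_Om xs_vi] := variational_solution N_gt0 Hab G_cont x0_Om G_mono.
have xs_nash := variational_nash Hab regular monotone extG xs_Om xs_vi.
exists xs; split => //.
  by move=> x' nx'; exact: (nash_unique Hab regular monotone extG xs_nash).
have := noise_series_cvg Hab x0_Om G_cont run
  d_gt0 gamma_gt0 gamma2_tails.
apply: filterS => w Hw i.
pose X k i := x i k w; pose Y k i := y i k w.
pose b k i := bias y yt trig i k w; pose m k i := noise y yt trig i k w.
have X_Om k j : Om j (X k j) by exact: (run_x_Om x0_Om run).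
have b_vanishes : vanishes b.
  move=> j; apply: sqr_cvg0.
  pose K := `|(ln sigma - ln a) / c|.
  apply: (@squeeze_cvgr _ _ _ _ (fun=> 0) (fun k => gamma k * K)).
  - near=> k; rewrite sqr_ge0/=.
    exact: (bias_le run gamma_gt0 _ _ _ c_gt0 a_gt0 (lt_trans ltr01 sigma_gt1)).
  - exact: cvg_cst.
  - by rewrite -[X in _ --> X](mul0r K); exact: cvgMl.
have Y_step k j : Y k.+1 j = Y k j +
    gamma k * laplacian L (fun j => Y k j + b k j + m k j) j + X k.+1 j - X k j.
  rewrite /Y (run_y run) (laplacianE L_weights (fun l => yt l k w)).
  by congr (_ + _ * laplacian L _ _ + _ - _); apply/funext => l; exact: broadcastE.
have X_step k j : is_proj (Om j) (X k j - lambda k * G j (X k j, Y k j)) (X k.+1 j).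
  exact: (run_x run).
have Y_init j : Y 0%N j = X 0%N j by exact: (run_y0 run).
have [B _ HB] := gradients_bounded e_connected L_weights N_gt0 Hab G_cont
  gamma_gt0 gamma_cvg0 X_Om Y_init Y_step b_vanishes Hw.
have XY := estimates_consensus e_connected L_weights N_gt0 Hab G_cont
  lambda_gt0 gamma_gt0 gamma_div gamma_cvg0 ratio_tails X_Om X_step
  Y_init Y_step b_vanishes Hw.
have Xxs := gradient_play_cvg N_gt0 Hab G_cont G_mono xs_Om xs_vi
  lambda_gt0 lambda_cvg0 lambda_div X_Om X_step HB XY.
rewrite -[X in _ --> X](normr0 R); apply: cvg_norm; exact: Xxs.
Unshelve. all: by end_near. Qed.
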